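(* Let $\Sigma$ be a simplicial fan and let $\alpha \in A^k(\Sigma)^*$ with $1 \le k \le d$. If $\mathscr{K}_{\hat\alpha}$ is nonempty, then $\alpha$ is hereditary Lorentzian if and only if (C) $\tau\Delta_{\hat\alpha}$ is $H$-connected, and (Q) for all $S \in \Delta_{\hat\alpha}$ with $|S| = k-2$, the Hessian of $\hat\alpha^S$ has at most one positive eigenvalue.
   Context: $\Sigma$ is a simplicial fan of dimension $d$ in a finite-dimensional real vector space $\mathcal{V}$, with specified ray vectors $\rho_i$, $i \in V$, generating its one-dimensional cones (the fan need not be rational). $\Delta(\Sigma) = \{S\subseteq V : \{\rho_i\}_{i\in S}$ generates a cone of $\Sigma\}$ and $L(\Sigma) = \{(\lambda(\rho_i))_{i\in V} : \lambda\in\mathcal{V}^*\}$. The Chow ring is $A(\Sigma) = \bigoplus_k A^k(\Sigma) = \mathbb{R}[x_i : i\in V]/(I+J)$, where $I$ is generated by the monomials $\prod_{i\in T}x_i$ with $T \notin \Delta(\Sigma)$ and $J$ by the linear forms $\sum_i \ell_i x_i$, $\ell\in L(\Sigma)$. For $\alpha\in A^k(\Sigma)^*$, $\hat\alpha(\mathbf{t}) = \frac{1}{k!}\alpha\big((\sum_{i\in V}t_ix_i)^k\big)\in\mathbb{R}[t_i:i\in V]$; $\hat\alpha$ is a hereditary polynomial, and $\alpha$ is called hereditary Lorentzian if $\hat\alpha$ is. General definitions: $D_\mathbf{u} = \sum u_i\partial_i$, $\partial^S = \prod_{i\in S}\partial_i$; $L_f = \{\mathbf{v}:D_\mathbf{v}f\equiv0\}$;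 $\Delta_f = \{S:\partial^Sf\not\equiv0\}$; $\tau\Delta$ is $\Delta$ with facets removed; $\mathrm{lk}_\Delta(S)=\{T:T\cap S=\varnothing,S\cup T\in\Delta\}$ with vertex set $V_S$. $(\Delta,L)$ hereditary: for each $T\in\Delta$, $\ell\mapsto(\ell_i)_{i\in T}$ maps $L$ onto $\mathbb{R}^T$; $f$ hereditary: $(\tau\Delta_f,L_f)$ hereditary. $f^S=\partial^Sf|_{t_i=0,i\in S}$ (a polynomial in $t_j$, $j\in V_S$). For $S\in\tau\Delta_f$ choose $\ell^{(i)}\in L_f$ ($i\in S$) with $\ell^{(i)}_i=1$, $\ell^{(i)}_j=0$ for $j\in S\setminus\{i\}$; $\pi_S(\mathbf{x})=(\mathbf{x}-\sum_{i\in S}x_i\ell^{(i)})|_{V_S}$. $\mathscr{K}_f$: if $\deg f=1$, $\{\mathbf{v}:f(\mathbf{v})>0\}$; else $(\mathbb{R}^V_{>0}+L_f)\cap\{\mathbf{v}:\pi_{\{i\}}(\mathbf{v})\in\mathscr{K}_{f^{\{i\}}}$ for all vertices $i$ of $\Delta_f\}$. For an open convex cone $\mathscr{K}$, a degree-$m\ge1$ homogeneous $g$ is $\mathscr{K}$-Lorentzian if for all $\mathbf{v}_1,\dots,\mathbf{v}_m\in\mathscr{K}$, $D_{\mathbf{v}_1}\cdots D_{\mathbf{v}_m}g>0$ and (if $m\ge2$) $(\mathbf{x},\mathbf{y})\mapsto D_\mathbf{x}D_\mathbf{y}D_{\mathbf{v}_3}\cdots D_{\mathbf{v}_m}g$ has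 exactly one positive eigenvalue; nonnegative constants are $\mathscr{K}$-Lorentzian. Hereditary $f$ is hereditary Lorentzian if $f^S$ is $\mathscr{K}_{f^S}$-Lorentzian for all $S\in\tau\Delta_f$. A pure $(m-1)$-dimensional complex $\Delta$ is $H$-connected if $\mathrm{lk}_\Delta(S)$ is connected for every $S\in\Delta$ with $|S|\le m-2$ (zero-dimensional complexes are $H$-connected). *)

(* Defs.v *)
From HB Require Import structures.
From mathcomp Require Import all_boot all_order all_algebra.
From mathcomp Require Import ring_quotient.
From mathcomp Require Import boolp classical_sets reals.
From mathcomp Require Import mpoly.

Set Implicit Arguments.
Unset Strict Implicit.
Unset Printing Implicit Defensive.

Import Order.TTheory GRing.Theory Num.Theory.

Local Open Scope ring_scope.
Local Open Scope quotient_scope.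

(** * Abstract simplicial complexes on the ground set ['I_n] *)

Section Complexes.
Context {n : nat}.
Implicit Types (D : {set {set 'I_n}}) (S T : {set 'I_n}).

Definition is_facet D S := (S \in D) && [forall T in D, (S \subset T) ==> (T == S)].

Definition trunc D : {set {set 'I_n}} := [set S in D | ~~ is_facet D S].

Definition link D S : {set {set 'I_n}} := [set T : {set 'I_n} | [disjoint T & S] & S :|: T \in D].

Definition vertices D : {set 'I_n} := [set i | [set i] \in D].

(* For a down-closed [D], connectedness of the 1-skeleton. *)
Definition complex_connected D : Prop :=
  {in vertices D &, forall i j, connect (fun a b => [set a; b] \in D) i j}.

(* The dimension of [D] plus one. *)
Definition complex_rank D : nat := \max_(S in D) #|S|.

Definition pure_complex D : Prop := forall S, is_facet D S -> #|S| = complex_rank D.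

Definition H_connected D : Prop :=
  pure_complex D /\
  forall S, S \in D -> (#|S| + 2 <= complex_rank D)%N -> complex_connected (link D S).

End Complexes.

(** * Hereditary Lorentzian polynomials

  For [W : {set 'I_n}], the space [R^W] is encoded as the vectors of ['rV[R]_n]
  supported in [W], and [R[t_i : i in W]] as the polynomials of [{mpoly R[n]}]
  in which only the variables of [W] occur.  A polynomial [f] is passed around
  with its variable set [W], and, where its degree matters, with the degree [m]
  in which it is homogeneous (so that [0] also has one). *)

Section Hereditary.
Context {R : realType} {n : nat}.
Implicit Types (W S T : {set 'I_n}) (f g : {mpoly R[n]}) (u v x : 'rV[R]_n).

Definition supported W v : Prop := forall i, i \notin W -> v 0 i = 0.

Definition positive_on W v : Prop :=
  supported W v /\ forall i, i \in W -> 0 < v 0 i.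

Definition restrict W v : 'rV[R]_n := \row_i (if i \in W then v 0 i else 0).

Definition dderiv u f : {mpoly R[n]} := \sum_(i < n) u 0 i *: f^`M(i).

Definition dderivs (vs : seq 'rV[R]_n) f : {mpoly R[n]} := foldr dderiv f vs.

(* [mesym1 S] is the exponent of the monomial [\prod_(i in S) 'X_i]. *)
Definition sderiv S f : {mpoly R[n]} := f^`M[mesym1 S].

Definition lin_space W f : set 'rV[R]_n :=
  [set v | supported W v /\ dderiv v f = 0]%classic.

Definition poly_complex W f : {set {set 'I_n}} :=
  [set S : {set 'I_n} | S \subset W & sderiv S f != 0].

Definition hereditary_pair (D : {set {set 'I_n}}) (L : set 'rV[R]_n) : Prop :=
  forall T, T \in D -> forall y : 'rV[R]_n,
    exists2 l, L l & forall i, i \in T -> l 0 i = y 0 i.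

Definition hereditary W f : Prop :=
  hereditary_pair (trunc (poly_complex W f)) (lin_space W f).

Definition link_poly S f : {mpoly R[n]} :=
  sderiv S f \mPo [tuple (if i \in S then 0 else 'X_i) | i < n].

(* The variable set of [link_poly S f]. *)
Definition link_vars W f S : {set 'I_n} := vertices (link (poly_complex W f) S).

Definition dual_vec W f S (i : 'I_n) : 'rV[R]_n :=
  xget 0 [set l | [/\ lin_space W f l, l 0 i = 1 &
                      forall j, j \in S -> j != i -> l 0 j = 0]]%classic.

Definition link_proj W f S x : 'rV[R]_n :=
  restrict (link_vars W f S) (x - \sum_(i in S) x 0 i *: dual_vec W f S i).

(* The value in degree 0 is a convention that plays no role: [K]-Lorentzian
   does not depend on [K] in degree 0. *)
Fixpoint lor_cone (m : nat) W f : set 'rV[R]_n :=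
  let pos_plus_L v :=
    exists p l, [/\ positive_on W p, lin_space W f l & v = p + l] in
  match m with
  | 0 => [set v | pos_plus_L v]%classic
  | m'.+1 =>
    if m' == 0%N then [set v | supported W v /\ 0 < f.@[v 0]]%classic
    else [set v | pos_plus_L v /\
      forall i, i \in vertices (poly_complex W f) ->
        lor_cone m' (link_vars W f [set i]) (link_poly [set i] f)
          (link_proj W f [set i] v)]%classic
  end.

(* Matrix of the bilinear form [(x, y) |-> D_x D_y q] on [R^W], for [q] a
   quadratic form: the second derivatives are then constants. *)
Definition hessian W (q : {mpoly R[n]}) : 'M[R]_#|W| :=
  \matrix_(i, j) (q^`M(enum_val i)^`M(enum_val j))@_0%MM.

(* [s] lists the eigenvalues of [A] with multiplicity. *)
Definition eigenvalues (p : nat) (A : 'M[R]_p) (s : seq R) : Prop :=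
  char_poly A = \prod_(a <- s) ('X - a%:P).

Definition exactly_one_pos_eigenvalue (p : nat) (A : 'M[R]_p) : Prop :=
  exists2 s, eigenvalues A s & count (fun a : R => 0 < a) s = 1%N.

Definition at_most_one_pos_eigenvalue (p : nat) (A : 'M[R]_p) : Prop :=
  exists2 s, eigenvalues A s & (count (fun a : R => (0 < a)%R) s <= 1)%N.

Definition K_Lorentzian (K : set 'rV[R]_n) (m : nat) W g : Prop :=
  if m == 0%N then exists2 c : R, 0 <= c & g = c%:MP
  else g \is m.-homog /\
    forall vs : seq 'rV[R]_n, size vs = m -> (forall v, v \in vs -> K v) ->
      0 < (dderivs vs g)@_0%MM /\
      ((2 <= m)%N -> exactly_one_pos_eigenvalue (hessian W (dderivs (drop 2 vs) g))).

Definition hereditary_Lorentzian (m : nat) W f : Prop :=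
  hereditary W f /\
  forall S, S \in trunc (poly_complex W f) ->
    K_Lorentzian (lor_cone (m - #|S|) (link_vars W f S) (link_poly S f))
                 (m - #|S|) (link_vars W f S) (link_poly S f).

End Hereditary.

(** * Simplicial fans *)

Section Fans.
Context {R : realType} {U : vectType R}.

Definition cone (s : seq U) : set U :=
  [set v | exists2 c : 'I_(size s) -> R,
      (forall i, 0 <= c i) & v = \sum_i c i *: s`_i]%classic.

Definition is_face (tau sigma : set U) : Prop :=
  exists2 lam : {linear U -> R^o},
    (forall v, sigma v -> 0 <= (lam v : R)) &
    tau = [set v | sigma v /\ lam v = 0]%classic.

Definition cone_dim (sigma : set U) (e : nat) : Prop :=
  exists2 X : {vspace U}, \dim X = e &
    (forall v, sigma v -> v \in X) /\
    (forall Y : {vspace U}, (forall v, sigma v -> v \in Y) -> (X <= Y)%VS).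

End Fans.

(* The rays are indexed by ['I_n].  As the origin is a face of
   every simplicial cone, [fan_zero] amounts to the nonemptiness of the fan. *)
Record simplicialFan (R : realType) (U : vectType R) (n : nat) := SimplicialFan {
  fan_cones : set (set U);
  ray : 'I_n -> U;
  fan_zero : fan_cones [set 0]%classic;
  fan_simplicial : forall sigma, fan_cones sigma ->
    exists2 s : seq U, free s & sigma = cone s;
  fan_face : forall sigma tau, fan_cones sigma -> is_face tau sigma ->
    fan_cones tau;
  fan_inter : forall sigma tau, fan_cones sigma -> fan_cones tau ->
    is_face (sigma `&` tau)%classic sigma /\ is_face (sigma `&` tau)%classic tau;
  ray_neq0 : forall i, ray i != 0;
  ray_cone : forall i, fan_cones (cone [:: ray i]);
  ray_inj : forall i j, cone [:: ray i] = cone [:: ray j] -> i = j;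
  ray_surj : forall v, v != 0 -> fan_cones (cone [:: v]) ->
    exists i, cone [:: v] = cone [:: ray i]
}.

(** * The Chow ring of a fan *)

Definition ideal_gen (A : comNzRingType) (G : set A) : set A :=
  [set a | exists2 s : seq (A * A), (forall q, q \in s -> G q.2) &
                                    a = \sum_(q <- s) q.1 * q.2]%classic.

Section ChowRing.
Context {R : realType} {U : vectType R} {n : nat} (Sigma : simplicialFan U n).
Implicit Types (p : {mpoly R[n]}).

Definition fan_dim (d : nat) : Prop :=
  (exists2 sigma, fan_cones Sigma sigma & cone_dim sigma d) /\
  (forall sigma e, fan_cones Sigma sigma -> cone_dim sigma e -> (e <= d)%N).

Definition fan_complex : set {set 'I_n} :=
  [set S | fan_cones Sigma (cone [seq ray Sigma i | i <- enum S])]%classic.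

Definition fan_lin : set 'rV[R]_n :=
  [set l | exists lam : {linear U -> R^o}, forall i, l 0 i = lam (ray Sigma i)]%classic.

Definition SR_ideal : set {mpoly R[n]} :=
  ideal_gen [set p | exists2 T : {set 'I_n}, ~ fan_complex T &
                                           p = \prod_(i in T) 'X_i]%classic.

Definition linear_ideal : set {mpoly R[n]} :=
  ideal_gen [set p | exists2 l, fan_lin l & p = \sum_i l 0 i *: 'X_i]%classic.

Definition chow_ideal : {pred {mpoly R[n]}} := fun r =>
  `[< exists p q, [/\ SR_ideal p, linear_ideal q & r = p + q] >].

Lemma ideal_gen_closed (A : comNzRingType) (G : set A) :
  [/\ ideal_gen G 0, (forall a b, ideal_gen G a -> ideal_gen G b -> ideal_gen G (a + b))
    & forall c a, ideal_gen G a -> ideal_gen G (c * a)].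
Proof.
split; first by exists [::] => //; rewrite big_nil.
  move=> _ _ [s hs ->] [t ht ->]; exists (s ++ t); last by rewrite big_cat.
  by move=> q; rewrite mem_cat => /orP[/hs|/ht].
move=> c _ [s hs ->]; exists [seq (c * q.1, q.2) | q <- s].
  by move=> _ /mapP[q /hs hq ->].
by rewrite big_map mulr_sumr; apply: eq_bigr => q _; rewrite mulrA.
Qed.

Lemma cone_nil : cone [::] = [set 0 : U]%classic.
Proof.
apply/seteqP; split=> v /=.
  by move=> [c _ ->]; rewrite big_ord0.
by move=> ->; exists (fun=> 0) => //; rewrite big_ord0.
Qed.

Lemma chow_ideal_eval0 p : p \in chow_ideal -> p.@[fun=> 0] = 0.
Proof.
have gen0 (G : set {mpoly R[n]}) (a : {mpoly R[n]}) :
    (forall g, G g -> g.@[fun=> 0] = 0) -> ideal_gen G a -> a.@[fun=> 0] = 0.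
  move=> hG [s hs ->]; rewrite raddf_sum /= big_seq big1 // => q /hs/hG hq.
  by rewrite mevalM hq mulr0.
move=> /asboolP[a [b [ha hb ->]]]; rewrite mevalD.
rewrite (gen0 _ _ _ ha) ?(gen0 _ _ _ hb) ?addr0 //.
  move=> _ [l _ ->]; rewrite raddf_sum /= big1 // => i _.
  by rewrite mevalZ mevalXU mulr0.
move=> _ [T nT ->]; have [T0|[i iT]] := set_0Vmem T.
  by case: nT; rewrite /fan_complex /= T0 enum_set0 cone_nil; apply: fan_zero.
by rewrite (bigD1 i) //= mevalM mevalXU mul0r.
Qed.

Lemma chow_idealr_closed : idealr_closed chow_ideal.
Proof.
have [I0 ID IM] := ideal_gen_closed (A := {mpoly R[n]})
  [set p | exists2 T : {set 'I_n}, ~ fan_complex T & p = \prod_(i in T) 'X_i]%classic.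
have [J0 JD JM] := ideal_gen_closed (A := {mpoly R[n]})
  [set p | exists2 l, fan_lin l & p = \sum_i l 0 i *: 'X_i]%classic.
split.
- by apply/asboolP; exists 0, 0; split; rewrite ?addr0.
- apply/negP => /chow_ideal_eval0 /eqP; rewrite meval1 oner_eq0 //.
move=> c _ _ /asboolP[a [b [ha hb ->]]] /asboolP[a' [b' [ha' hb' ->]]].
apply/asboolP; exists (c * a + a'), (c * b + b'); split.
- exact/ID/ha'/IM.
- exact/JD/hb'/JM.
- by rewrite mulrDr addrACA.
Qed.

HB.instance Definition _ :=
  isIdealr.Build {mpoly R[n]} chow_ideal chow_idealr_closed.

Definition chow_ring : comNzRingType := {ideal_quot chow_ideal}.

Definition to_chow (p : {mpoly R[n]}) : chow_ring := \pi_{ideal_quot chow_ideal} p.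

Definition chow_piece (k : nat) : set chow_ring :=
  [set a | exists2 p, p \is k.-homog & a = to_chow p]%classic.

(* An element of the dual of the degree [k] piece of the Chow ring is a function
   that is linear on that piece; its values elsewhere are irrelevant.  Scalars
   act on the Chow ring as classes of constant polynomials. *)
Record chow_dual (k : nat) := ChowDual {
  chow_dual_fun :> chow_ring -> R;
  chow_dual_linear : forall (c : R) (a b : chow_ring),
    chow_piece k a -> chow_piece k b ->
    chow_dual_fun (to_chow c%:MP * a + b) = c * chow_dual_fun a + chow_dual_fun b
}.

(* The polynomial [(\sum_i t_i x_i) ^+ k] in the variables [t_i], with
   coefficients in the degree [k] piece of the Chow ring. *)
Definition generic_power (k : nat) : {mpoly chow_ring[n]} :=
  (\sum_(i < n) to_chow 'X_i *: 'X_i) ^+ k.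

(* [alpha] is applied coefficientwise to the generic power. *)
Definition vol_poly (k : nat) (alpha : chow_dual k) : {mpoly R[n]} :=
  (k`!%:R)^-1 *: \sum_(mu <- msupp (generic_power k))
                    alpha (generic_power k)@_mu *: 'X_[mu].

End ChowRing.

(* Main.v *)
Require Import Defs.
From HB Require Import structures.
From mathcomp Require Import all_boot all_order all_algebra.
From mathcomp Require Import boolp classical_sets reals.
From mathcomp Require Import mpoly.
From mathcomp Require Import lra zify.
From mathcomp Require Import fintype finset.

(** Write [f] for the volume polynomial of [alpha] and [L] for its
    lineality space.  Linear forms on the fan lie in [L] and faces of the
    complex of [f] are cones of the fan, so [L] interpolates arbitrary values on
    every face, facets included.  Consequently the complex of [f] is pure, links
    of [f] are of the same kind, and the polarization of [link_poly S f] at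
    projected directions is that of the partial derivative of [f] along [S].

    Criterion => Lorentzian is by induction on the degree.  In degree at least
    3 write a direction of the cone as [v = p + l] with [p] positive and [l] in
    [L].  The Hessian [H] of a derivative of [f] containing [v] is the [p]-weighted
    sum of the Hessians of the links of the vertices, which have Lorentzian
    signature by induction.  With [D = diag (H p / p)], the vector [p] is a Perron
    eigenvector of [D^-1 H] for the eigenvalue 1, simple because the complex is
    connected, and the signatures of the links force any eigenvalue [a] to satisfy
    [a <= a ^ 2]; hence 1 is the only positive eigenvalue of [H].

    Conversely, if a link were disconnected, the parts of [p] on two pieces of its
    vertex set would be orthogonal positive directions of a Hessian. *)

Set Implicit Arguments.
Unset Strict Implicit.
Unset Printing Implicit Defensive.

Import Order.TTheory GRing.Theory Num.Theory.

Local Open Scope ring_scope.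
Local Open Scope quotient_scope.

(** * Real symmetric matrices *)

Section SymmetricMatrices.
Context {R : realType}.

Definition bform n (A : 'M[R]_n) (x y : 'rV[R]_n) : R := (x *m A *m y^T) 0 0.

Lemma bformE n (A : 'M[R]_n) x y : bform A x y = \sum_i \sum_j x 0 i * A i j * y 0 j.
Proof.
rewrite /bform mxE exchange_big /=; apply: eq_bigr => j _.
by rewrite !mxE mulr_suml; apply: eq_bigr.
Qed.

Lemma bformC n (A : 'M[R]_n) x y : A^T = A -> bform A x y = bform A y x.
Proof.
move=> symA; rewrite /bform -[LHS]/(((x *m A *m y^T) 0 0)).
by rewrite -[in LHS](trmxK (x *m A *m y^T)) mxE !trmx_mul trmxK symA mulmxA.
Qed.

Lemma bformDl n (A : 'M[R]_n) x y z : bform A (x + y) z = bform A x z + bform A y z.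
Proof. by rewrite /bform !mulmxDl mxE. Qed.

Lemma bformDr n (A : 'M[R]_n) x y z : bform A z (x + y) = bform A z x + bform A z y.
Proof. by rewrite /bform linearD mulmxDr mxE. Qed.

Lemma bformZl n (A : 'M[R]_n) a x z : bform A (a *: x) z = a * bform A x z.
Proof. by rewrite /bform -!scalemxAl mxE. Qed.

Lemma bformZr n (A : 'M[R]_n) a x z : bform A z (a *: x) = a * bform A z x.
Proof. by rewrite /bform linearZ /= -scalemxAr mxE. Qed.

Definition bform_lin := (bformDl, bformDr, bformZl, bformZr).

Lemma bform1 n (x : 'rV[R]_n) : bform 1%:M x x = \sum_i x 0 i ^+ 2.
Proof. by rewrite /bform mulmx1 mxE; apply: eq_bigr => i _; rewrite mxE expr2. Qed.

Lemma bform1_ge0 n (x : 'rV[R]_n) : 0 <= bform 1%:M x x.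
Proof. by rewrite bform1 sumr_ge0 // => i _; rewrite sqr_ge0. Qed.

Lemma bform1_eq0 n (x : 'rV[R]_n) : (bform 1%:M x x == 0) = (x == 0).
Proof.
apply/idP/eqP => [|->]; last by rewrite /bform !mul0mx mxE.
rewrite bform1 psumr_eq0 => [/allP h|i _]; last by rewrite sqr_ge0.
by apply/rowP => i; have := h i (mem_index_enum i); rewrite mxE sqrf_eq0 => /eqP.
Qed.

Lemma bform1_gt0 n (x : 'rV[R]_n) : x != 0 -> 0 < bform 1%:M x x.
Proof. by move=> x0; rewrite lt_def bform1_eq0 x0 bform1_ge0. Qed.

(** Each product [|x_i x_j|] is at most the squared norm of [x], so the sum of the [|A i j|] is a
    bound. The added 1 makes [K] positive, hence invertible, when the lemma is applied to an inverse
    matrix. *)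
Lemma bform_bounded n (A : 'M[R]_n) :
  exists2 K, 0 < K & forall x, bform A x x <= K * bform 1%:M x x.
Proof.
exists (1 + \sum_i \sum_j `|A i j|).
  by rewrite ltr_pwDl ?sumr_ge0 // => i _; rewrite sumr_ge0.
move=> x; set N := bform 1%:M _ _.
have sqN i : x 0 i ^+ 2 <= N.
  by rewrite /N bform1 (bigD1 i) //= lerDl sumr_ge0 // => j _; rewrite sqr_ge0.
rewrite mulrDl mul1r -[leLHS]add0r lerD ?bform1_ge0 // bformE mulr_suml.
apply: ler_sum => i _; rewrite mulr_suml; apply: ler_sum => j _.
apply: le_trans (ler_norm _) _; rewrite !normrM mulrAC mulrC ler_wpM2l //.
have := sqN i; have := sqN j; rewrite -[x 0 i ^+ 2]real_normK ?num_real //.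
rewrite -[x 0 j ^+ 2]real_normK ?num_real //; nra.
Qed.

(* The infimum [c] of the [K] with [A <= K] is an eigenvalue: if [c - A] were
   invertible, it would be bounded below by some [1 / K > 0]. *)
Lemma symmetric_eigenvalue n (A : 'M[R]_n.+1) : A^T = A -> exists a, eigenvalue A a.
Proof.
move=> symA; pose E := [set K : R | forall x, bform A x x <= K * bform 1%:M x x]%classic.
have E0 : (E !=set0)%classic by have [K _ hK] := bform_bounded A; exists K.
have ray x K : x != 0 -> E K -> bform A x x / bform 1%:M x x <= K.
  by move=> x0 EK; rewrite ler_pdivrMr ?bform1_gt0 //; apply: EK.
have hE : has_inf E.
  split=> //; pose e := delta_mx 0 0 : 'rV[R]_n.+1.
  have e0 : e != 0.
    by apply/eqP=> /rowP/(_ 0) /eqP; rewrite !mxE eqxx oner_eq0.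
  by exists (bform A e e / bform 1%:M e e) => K; apply: ray.
pose c := inf E.
have Ec : E c.
  move=> x; have [->|x0] := eqVneq x 0; first by rewrite /bform !mul0mx mxE mulr0.
  rewrite -ler_pdivrMr ?bform1_gt0 //; apply: lb_le_inf => // K.
  exact: ray.
pose M := c%:M - A.
have symM : M^T = M by rewrite /M linearB /= tr_scalar_mx symA.
have ME x y : bform M x y = c * bform 1%:M x y - bform A x y.
  by rewrite /bform mulmxBr mulmxBl mul_mx_scalar mulmx1 -scalemxAl !mxE.
exists c; rewrite -[eigenvalue _ _]negbK; apply/negP => nev.
have Mu : M \in unitmx.
  move: nev; rewrite negbK kermx_eq0 row_free_unit => Au.
  by rewrite /M -opprB -scaleN1r unitmxZ ?unitrN1.
have [K K0 hK] := bform_bounded (invmx M).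
(* Expanding [0 <= M] at [x - K^-1 *: y] with [y M = x] and using [invmx M <= K] gives [M >= K^-1],
   that is [A <= c - K^-1]. *)
have : E (c - K^-1).
  move=> x; pose y := x *m invmx M.
  have yM : y *m M = x by rewrite mulmxKV.
  have : 0 <= bform M (x - K^-1 *: y) (x - K^-1 *: y) by rewrite ME subr_ge0; apply: Ec.
  rewrite -scaleNr !bform_lin (bformC y) // [bform M x y]bformC //.
  have -> : bform M y x = bform 1%:M x x by rewrite /bform yM mulmx1.
  have -> : bform M y y = bform (invmx M) x x.
    by rewrite /bform yM /y trmx_mul trmx_inv symM mulmxA.
  have := hK x; rewrite ME; set N := bform 1%:M x x => h1 h2.
  have N0 : 0 <= N := bform1_ge0 x.
  suff : K^-1 * (K^-1 * bform (invmx M) x x) <= K^-1 * N by nra.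
  by rewrite ler_pM2l ?invr_gt0 // mulrC ler_pdivrMr // mulrC.
move=> Ec'; have : c <= c - K^-1 by apply: ge_inf; first by case: hE.
by rewrite lerBrDr gerDl leNgt invr_gt0 K0.
Qed.

Definition orthogonal_mx n (Q : 'M[R]_n) := Q *m Q^T = 1%:M.

(* The Householder reflection exchanging two unit vectors. *)
Lemma orthogonal_transport n (u v : 'rV[R]_n) :
  u *m u^T = 1%:M -> v *m v^T = 1%:M ->
  exists2 P : 'M[R]_n, orthogonal_mx P & u *m P = v.
Proof.
move=> hu hv; have [->|uv] := eqVneq u v.
  by exists 1%:M; rewrite ?mulmx1 // /orthogonal_mx trmx1 mulmx1.
have [w wE] : exists w, w = v - u by exists (v - u).
pose s := (v *m u^T) 0 0.
have vu : v *m u^T = s%:M by rewrite [LHS]mx11_scalar.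
have vu' : u *m v^T = s%:M.
  by rewrite -[LHS]trmxK trmx_mul trmxK vu tr_scalar_mx.
have uw : u *m w^T = (s - 1)%:M by rewrite wE linearB mulmxBr vu' hu -raddfB.
have ww : w *m w^T = (2 - s *+ 2)%:M.
  rewrite wE linearB /= mulmxBl !mulmxBr hu hv vu vu' -!raddfB; congr _%:M; lra.
have c0 : 1 - s != 0.
  apply: contraNneq uv => s1; rewrite -subr_eq0 -oppr_eq0 opprB -wE -bform1_eq0.
  by rewrite /bform mulmx1 ww mxE eqxx mulr1n; apply/eqP; lra.
(* As [w w^T = 2 (1 - s)], this is the usual reflection [1 - 2 w^T w / |w|^2]. *)
pose P := 1%:M - (1 - s)^-1 *: (w^T *m w).
have PT : P^T = P by rewrite /P linearB /= linearZ /= trmx1 trmx_mul trmxK.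
exists P.
  rewrite /orthogonal_mx PT /P mulmxBl mul1mx mulmxBr mulmx1.
  rewrite -scalemxAl -scalemxAr mulmxA -(mulmxA w^T) ww mul_mx_scalar.
  rewrite -scalemxAl !scalerA -addrA -opprD -[RHS]subr0; congr (_ - _).
  rewrite -scalerBl -scalerDl; apply/eqP; rewrite scaler_eq0; apply/orP; left.
  have kE : (1 - s)^-1 * ((1 - s)^-1 * (1 - s)) = (1 - s)^-1 by rewrite mulVf ?mulr1.
  by apply/eqP; move: kE; set k := (1 - s)^-1; lra.
rewrite /P mulmxBr mulmx1 -scalemxAr mulmxA uw mul_scalar_mx scalerA.
have -> : (1 - s)^-1 * (s - 1) = -1 by rewrite -[s - 1]opprB mulrN mulVf.
by rewrite scaleN1r opprK wE addrCA subrr addr0.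
Qed.

(** Deflation: an orthogonal change of basis sends the first basis vector to a unit eigenvector,
    after which symmetry makes the matrix block diagonal, and the smaller block is treated by
    induction. *)
Lemma real_spectral n (A : 'M[R]_n) : A^T = A ->
  exists Q (d : 'rV[R]_n), orthogonal_mx Q /\ A = Q^T *m diag_mx d *m Q.
Proof.
elim: n A => [|n IH] A symA.
  by exists 1%:M, 0; split; [rewrite /orthogonal_mx trmx1 mulmx1 | apply/matrixP=> -[]].
have [a /eigenvalueP[v0 v0A v0n]] := symmetric_eigenvalue symA.
pose r := Num.sqrt (bform 1%:M v0 v0).
have r0 : 0 < r by rewrite sqrtr_gt0 bform1_gt0.
pose v := r^-1 *: v0.
have vA : v *m A = a *: v by rewrite -scalemxAl v0A scalerA mulrC -scalerA.
have vv : v *m v^T = 1%:M.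
  rewrite [LHS]mx11_scalar; congr _%:M.
  rewrite -[v]mulmx1 trmx_mul trmx1 mulmxA mulmx1 -/(bform _ v v) !bform_lin mulrA -expr2.
  by rewrite -[bform _ _ _]sqr_sqrtr ?bform1_ge0 // -exprMn mulVf ?expr1n ?gt_eqF.
pose e := row_mx 1%:M 0 : 'rV[R]_(1 + n).
have ee : e *m e^T = 1%:M by rewrite tr_row_mx mul_row_col trmx1 trmx0 mulmx0 mulmx1 addr0.
have [P oP eP] := orthogonal_transport ee vv.
pose B : 'M[R]_(1 + n) := P *m A *m P^T.
have symB : B^T = B by rewrite /B !trmx_mul trmxK symA mulmxA.
have eB : e *m B = a *: e.
  rewrite /B !mulmxA eP vA -scalemxAl -eP -mulmxA; congr (_ *: _).
  by rewrite oP mulmx1.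
have PP : P^T *m P = 1%:M by apply: mulmx1C.
have AE : A = P^T *m B *m P by rewrite /B !mulmxA PP mul1mx -mulmxA PP mulmx1.
have uB : usubmx B = row_mx a%:M 0.
  move: eB; rewrite -[B in e *m B]vsubmxK mul_row_col mul1mx mul0mx addr0 => ->.
  by rewrite scale_row_mx scaler0 scale_scalar_mx mulr1.
have BE : B = block_mx a%:M 0 0 (drsubmx B).
  rewrite -[LHS]submxK; congr block_mx.
  - by rewrite /ulsubmx uB row_mxKl.
  - by rewrite /ursubmx uB row_mxKr.
  - by rewrite -[LHS]trmxK trmx_dlsub symB /ursubmx uB row_mxKr trmx0.
have [|Q [d [oQ QE]]] := IH (drsubmx B); first by rewrite trmx_drsub symB.
pose Q1 : 'M[R]_(1 + n) := block_mx 1%:M 0 0 Q.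
have oQ1 : Q1 *m Q1^T = 1%:M.
  rewrite /Q1 tr_block_mx mulmx_block !trmx0 trmx1 !mulmx0 !mul0mx !addr0 !add0r mulmx1.
  by rewrite oQ -scalar_mx_block.
have BQ : B = Q1^T *m diag_mx (row_mx a%:M d) *m Q1.
  rewrite BE {1}QE diag_mx_row /Q1 tr_block_mx !trmx0 trmx1 !mulmx_block.
  rewrite !(mulmx0, mul0mx, addr0, add0r, mulmx1, mul1mx).
  by congr (block_mx _ 0 0 _); apply/matrixP=> i j; rewrite !mxE !ord1 mulr1n.
exists (Q1 *m P), (row_mx a%:M d); split.
  by rewrite /orthogonal_mx trmx_mul -mulmxA (mulmxA P) oP mul1mx.
by rewrite [LHS]AE {1}BQ trmx_mul !mulmxA.
Qed.

End SymmetricMatrices.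

(** Eigenvalue lists are thus unique up to permutation, so a count of positive eigenvalues can be
    read on any one of them. *)
Lemma prod_XsubC_inj (F : fieldType) (s t : seq F) :
  \prod_(a <- s) ('X - a%:P) = \prod_(a <- t) ('X - a%:P) -> perm_eq s t.
Proof.
elim: s t => [|a s IH] t h.
  have := size_prod_XsubC t id; rewrite -h big_nil size_poly1 => -[] /esym/size0nil ->.
  exact: perm_refl.
have at_ : a \in t by rewrite -root_prod_XsubC -h big_cons rootM root_XsubC eqxx.
rewrite perm_sym; apply: perm_trans (perm_to_rem at_) _; rewrite perm_cons perm_sym.
apply: IH; move: h; rewrite (perm_big _ (perm_to_rem at_)) !big_cons.
by apply: mulfI; rewrite polyXsubC_eq0.
Qed.

(** * Signatures of symmetric matrices *)

Section Signature.
Context {R : realType}.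

Lemma row_orthogonal n (Q : 'M[R]_n) i : orthogonal_mx Q -> row i Q *m Q^T = delta_mx 0 i.
Proof. by move=> oQ; rewrite -row_mul oQ rowE mulmx1. Qed.

Lemma spectral_form n (A : 'M[R]_n) : A^T = A ->
  exists (Q : 'M[R]_n) (d : 'I_n -> R),
    [/\ orthogonal_mx Q,
      forall x y, bform A x y = \sum_i d i * (x *m Q^T) 0 i * (y *m Q^T) 0 i,
      forall i, row i Q *m A = d i *: row i Q
    & eigenvalues A [seq d i | i <- enum 'I_n]].
Proof.
move=> symA; have [Q [d [oQ AE]]] := real_spectral symA.
have oQ' : Q^T *m Q = 1%:M by apply: mulmx1C.
exists Q, (d 0); split=> //.
- move=> x y; rewrite /bform AE !mulmxA -(mulmxA _ Q) -[Q in _ *m (Q *m _)]trmxK -trmx_mul mxE.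
  by apply: eq_bigr => i _; rewrite mul_mx_diag !mxE; congr (_ * _); rewrite mulrC.
- by move=> i; rewrite AE !mulmxA row_orthogonal // -rowE row_diag_mx -scalemxAl -rowE.
rewrite /eigenvalues /char_poly.
have -> : char_poly_mx A = map_mx polyC Q^T *m char_poly_mx (diag_mx d) *m map_mx polyC Q.
  rewrite /char_poly_mx mulmxBr mulmxBl -!map_mxM -AE scalar_mxC -mulmxA -map_mxM.
  by rewrite oQ' map_mx1 mulmx1.
rewrite !det_mulmx mulrC mulrA -det_mulmx -map_mxM /= oQ map_mx1 det1 mul1r.
rewrite -/(char_poly _) char_poly_trig ?diag_mx_is_trig // big_map big_enum /=.
by apply: eq_bigr => i _; rewrite !mxE eqxx mulr1n.
Qed.

Lemma count_pos n (d : 'I_n -> R) :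
  count (fun a : R => 0 < a) [seq d i | i <- enum 'I_n] = #|[pred i | 0 < d i]|.
Proof. by rewrite count_map enumT cardE /enum_mem size_filter; apply: eq_count. Qed.

Lemma sum_gt0_ex (I : finType) (F : I -> R) : 0 < \sum_i F i -> exists i, 0 < F i.
Proof.
move=> h; apply/existsP; rewrite -[X in is_true X]negbK negb_exists; apply/negP => /forallP F0.
by move: h; rewrite ltNge sumr_le0 // => i _; rewrite leNgt.
Qed.

(** Reverse Cauchy-Schwarz inequality: a single spectral coordinate carries a positive eigenvalue,
    and the form is nonpositive wherever that coordinate vanishes. *)
Lemma at_most_one_pos_CS n (A : 'M[R]_n) : A^T = A ->
  at_most_one_pos_eigenvalue A ->
  forall x y, 0 < bform A y y -> bform A x x * bform A y y <= bform A x y ^+ 2.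
Proof.
move=> symA [s eA cs] x y hy.
have [Q [d [oQ bE qE sE]]] := spectral_form symA.
have /card_le1_eqP cd : (#|[pred i | (0 < d i)%R]| <= 1)%N.
  by rewrite -count_pos -(permP (prod_XsubC_inj (etrans (esym eA) sE))).
have [i0 hi0] : exists i, 0 < d i * (y *m Q^T) 0 i * (y *m Q^T) 0 i.
  by apply: sum_gt0_ex; rewrite -bE.
set a := (y *m Q^T) 0 i0 in hi0; pose b := (x *m Q^T) 0 i0.
rewrite -mulrA -expr2 in hi0.
have a0 : a != 0 by apply: contraTneq hi0 => ->; rewrite expr0n mulr0 ltxx.
have d0 : 0 < d i0 by move: hi0; rewrite pmulr_lgt0 // exprn_even_gt0.
(* This combination cancels the coordinate [i0] of the positive eigenvalue. *)
pose z := a *: x - b *: y.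
have : bform A z z <= 0.
  rewrite bE sumr_le0 // => i _; rewrite -mulrA -expr2.
  have [->|ii0] := eqVneq i i0.
    have -> : (z *m Q^T) 0 i0 = a * b - b * a.
      by rewrite /z mulmxBl -!scalemxAl /a /b; move: (x *m _) (y *m _) => u v; rewrite !mxE.
    by rewrite [b * a]mulrC subrr expr0n mulr0.
  rewrite mulr_le0_ge0 ?sqr_ge0 // leNgt; apply/negP=> di.
  by rewrite (cd i i0) ?eqxx in ii0.
rewrite /z -scaleNr !bform_lin (bformC y x) //.
set X := bform A x x; set Y := bform A y y in hy *; set M := bform A x y => h.
have h2 : Y * (a * (a * X + - b * M) + - b * (a * M + - b * Y)) <= 0.
  by rewrite pmulr_rle0 //; move: h; lra.
have a2 : 0 < a ^+ 2 by rewrite exprn_even_gt0.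
(* After multiplication by [a ^ 2], the inequality [h2] leaves exactly the square of [b Y - a M]. *)
rewrite -(ler_pM2l a2).
have := sqr_ge0 (b * Y - a * M); nra.
Qed.

Lemma exactly_one_pos_at_most n (A : 'M[R]_n) :
  exactly_one_pos_eigenvalue A -> at_most_one_pos_eigenvalue A.
Proof. by move=> [s eA cs]; exists s; rewrite ?cs. Qed.

(** Positivity at [y] yields a positive eigenvalue. Two of them would span a plane on which the form
    is positive definite, and this plane meets the orthogonal of [y]. *)
Lemma exactly_one_pos_intro n (A : 'M[R]_n) y : A^T = A -> 0 < bform A y y ->
  (forall x, bform A x y = 0 -> bform A x x <= 0) -> exactly_one_pos_eigenvalue A.
Proof.
move=> symA hy hx; have [Q [d [oQ bE qE sE]]] := spectral_form symA.
exists [seq d i | i <- enum 'I_n] => //; rewrite count_pos.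
have qq i j : bform A (row i Q) (row j Q) = d i * (i == j)%:R.
  rewrite bE (bigD1 i) //= !row_orthogonal // big1 ?addr0.
    by rewrite !mxE !eqxx /= mulr1.
  by move=> k ki; rewrite !mxE (negPf ki) andbF mulr0 mul0r.
have nz i : 0 < d i -> bform A (row i Q) y != 0.
  move=> di; apply/eqP => /hx; rewrite qq eqxx mulr1 leNgt di //.
apply/eqP; rewrite eqn_leq; apply/andP; split; last first.
  have : exists i, 0 < d i * (y *m Q^T) 0 i * (y *m Q^T) 0 i.
    by apply: sum_gt0_ex; rewrite -bE.
  move=> [i]; rewrite -mulrA -expr2 => hi; apply/card_gt0P; exists i; rewrite inE.
  by rewrite ltNge; apply: contraTN hi => di; rewrite -leNgt mulr_le0_ge0 ?sqr_ge0.
apply/card_le1_eqP => i j; rewrite !inE => di dj; apply/eqP/negPn/negP => ij.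
pose b i := bform A (row i Q) y.
(* The coefficients are chosen to make this combination orthogonal to [y]. *)
have := hx (b j *: row i Q - b i *: row j Q).
rewrite -scaleNr !bform_lin !qq !eqxx (negPf ij) eq_sym (negPf ij) -/(b i) -/(b j) => h.
have {h} : b j * (b j * (d i * 1)) + b i * (b i * d j) <= 0.
  apply: le_trans (h _); last by rewrite mulrC mulNr subrr.
  rewrite /= !mulr0n !mulr1n; lra.
have := nz i di; rewrite -/(b i) => bi0.
have : 0 < b i * (b i * d j) by rewrite mulrA -expr2 mulr_gt0 // exprn_even_gt0.
have : 0 <= b j * (b j * (d i * 1)) by rewrite mulr1 mulrA -expr2 mulr_ge0 ?sqr_ge0 ?ltW.
lra.
Qed.

(* With [c := w H] and [D := diag (c / w)], [w] is a Perron eigenvector of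
   [D^-1 H] for the eigenvalue 1, which is simple by connectedness; the last
   hypothesis forces every other eigenvalue to be nonpositive or at least 1. *)
Lemma trickle_down n (H : 'M[R]_n) (w : 'rV[R]_n) : H^T = H ->
  (forall i, 0 < w 0 i) -> (forall i, 0 < (w *m H) 0 i) ->
  (forall i j, i != j -> 0 <= H i j) ->
  (forall r : 'I_n -> R, (forall i j, i != j -> 0 < H i j -> r i = r j) ->
     forall i j, r i = r j) ->
  (forall x, bform H x x <= \sum_i w 0 i * (x *m H) 0 i ^+ 2 / (w *m H) 0 i) ->
  forall x, bform H x w = 0 -> bform H x x <= 0.
Proof.
move=> symH w0; set c := w *m H => c0 H0 conn hq x xw.
(* [s] is the square root of the diagonal [D]. The matrix [A] below is the symmetric conjugate of
   [D^-1 H], to which the spectral theorem applies. *)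
pose s := \row_i Num.sqrt (c 0 i / w 0 i).
have s0 i : 0 < s 0 i by rewrite mxE sqrtr_gt0 divr_gt0.
have ss i : s 0 i ^+ 2 = c 0 i / w 0 i.
  by rewrite mxE sqr_sqrtr // divr_ge0 // ltW.
pose A := \matrix_(i, j) (H i j / (s 0 i * s 0 j)).
have HC i j : H i j = H j i by rewrite -[in LHS]symH mxE.
have symA : A^T = A by apply/matrixP=> i j; rewrite mxE [LHS]mxE [RHS]mxE HC [s 0 j * _]mulrC.
have [Q [d [oQ bE qE _]]] := spectral_form symA.
pose y := \row_i (x 0 i * s 0 i).
have -> : bform H x x = bform A y y.
  rewrite !bformE; apply: eq_bigr => i _; apply: eq_bigr => j _.
  rewrite [y 0 i]mxE [y 0 j]mxE [A i j]mxE invfM.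
  have ui : s 0 i / s 0 i = 1 by rewrite divff ?gt_eqF.
  have uj : s 0 j / s 0 j = 1 by rewrite divff ?gt_eqF.
  transitivity (x 0 i * H i j * x 0 j * (s 0 i / s 0 i) * (s 0 j / s 0 j)); last by lra.
  by rewrite ui uj !mulr1.
rewrite bE sumr_le0 // => i _; rewrite -mulrA -expr2.
have [di|di] := leP (d i) 0; first by rewrite mulr_le0_ge0 ?sqr_ge0.
(* Undoing the conjugation turns the unit eigenvector [q] of [A] into a solution [z] of
   [z H = d i z D], normalized by [z D z^T = 1]. *)
pose q := row i Q; pose z := \row_j (q 0 j / s 0 j).
have zH j : (z *m H) 0 j = d i * z 0 j * (c 0 j / w 0 j).
  have := qE i => /rowP/(_ j); rewrite [RHS]mxE -/q mxE => hj.
  have uj : s 0 j / s 0 j = 1 by rewrite divff ?gt_eqF.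
  transitivity (d i * q 0 j * s 0 j * (s 0 j / s 0 j)).
    rewrite uj mulr1 -hj mxE mulr_suml; apply: eq_bigr => k _.
    rewrite [z 0 k]mxE [A k j]mxE invfM.
    transitivity (q 0 k / s 0 k * H k j * (s 0 j / s 0 j)); first by rewrite uj mulr1.
    by lra.
  by rewrite -ss [z 0 j]mxE; lra.
pose N := \sum_j z 0 j ^+ 2 * (c 0 j / w 0 j).
have N1 : N = 1.
  have -> : N = (q *m q^T) 0 0.
    rewrite mxE; apply: eq_bigr => j _; rewrite -ss mxE [q^T _ _]mxE.
    by rewrite expr_div_n divfK ?expf_neq0 ?gt_eqF // expr2.
  by rewrite /q tr_row colE mulmxA row_orthogonal // mul_delta_mx mxE !eqxx.
have zz : bform H z z = d i.
  rewrite /bform mxE -[RHS]mulr1 -N1 mulr_sumr; apply: eq_bigr => j _.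
  by rewrite zH !mxE expr2; lra.
(* At [z] the last hypothesis reads [d i <= d i ^ 2], and [d i] is positive here. *)
have d1 : 1 <= d i.
  have := hq z; rewrite zz.
  suff -> : \sum_j w 0 j * (z *m H) 0 j ^+ 2 / c 0 j = d i ^+ 2 by rewrite expr2 -{1}[d i]mulr1 ler_pM2l.
  rewrite -[RHS]mulr1 -N1 mulr_sumr; apply: eq_bigr => j _; rewrite zH.
  have cj := c0 j; have wj := w0 j; set C := c 0 j in cj *; set W := w 0 j in wj *.
  have uc : C / C = 1 by rewrite divff ?gt_eqF.
  have uw : W / W = 1 by rewrite divff ?gt_eqF.
  transitivity (d i ^+ 2 * (z 0 j ^+ 2 * (C / W)) * (W / W) * (C / C)); first by lra.
  by rewrite uc uw !mulr1.
pose r j := z 0 j / w 0 j.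
have zr j : z 0 j = r j * w 0 j by rewrite divfK ?gt_eqF.
(* The Dirichlet energy of [r = z / w]. It is nonnegative, its diagonal terms being zero, and it
   equals [2 (1 - d i) <= 0]. So it vanishes and [r] is constant. *)
pose T := \sum_j \sum_k H j k * w 0 j * w 0 k * (r j - r k) ^+ 2.
have TE : T = (1 - d i) *+ 2.
  have N2 : \sum_j \sum_k H j k * w 0 j * w 0 k * r k ^+ 2 = 1.
    rewrite -N1 exchange_big; apply: eq_bigr => k _.
    transitivity (c 0 k * w 0 k * r k ^+ 2).
      rewrite mxE !mulr_suml; apply: eq_bigr => j _; lra.
    rewrite /r expr_div_n [w 0 k ^+ 2]expr2 invfM.
    have uw : w 0 k / w 0 k = 1 by rewrite divff ?gt_eqF.
    transitivity (z 0 k ^+ 2 * (c 0 k / w 0 k) * (w 0 k / w 0 k)); first by lra.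
    by rewrite uw mulr1.
  have N3 : \sum_j \sum_k H j k * w 0 j * w 0 k * r j ^+ 2 = 1.
    rewrite exchange_big -N2; apply: eq_bigr => j _; apply: eq_bigr => k _.
    by rewrite HC; lra.
  rewrite -zz mulr2n -{1}N2 -N3 bformE.
  rewrite /T -!sumrB -big_split; apply: eq_bigr => j _.
  rewrite -!sumrB -big_split; apply: eq_bigr => k _ /=; rewrite !zr; lra.
have Tp j k : 0 <= H j k * w 0 j * w 0 k * (r j - r k) ^+ 2.
  have [->|jk] := eqVneq j k; first by rewrite subrr expr0n mulr0.
  by rewrite mulr_ge0 ?sqr_ge0 // !mulr_ge0 ?H0 // ltW.
have T0 : T = 0.
  apply: le_anti; apply/andP; split; first by rewrite TE; lra.
  by rewrite sumr_ge0 // => j _; rewrite sumr_ge0.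
have rr : forall j k, r j = r k.
  apply: conn => j k jk Hjk; move/eqP: T0; rewrite /T psumr_eq0; last first.
    by move=> l _; rewrite sumr_ge0.
  move=> /allP/(_ j (mem_index_enum j)); rewrite /= psumr_eq0 //.
  move=> /allP/(_ k (mem_index_enum k)); rewrite /= mulf_eq0 sqrf_eq0 subr_eq0.
  by rewrite gt_eqF ?mulr_gt0 //= => /eqP.
(* With [r] constant, [z] is a multiple of [w], so this coordinate of [y] is a multiple of
   [bform H x w]. *)
suff -> : (y *m Q^T) 0 i = 0 by rewrite expr0n mulr0.
transitivity (r i * bform H x w); last by rewrite xw mulr0.
rewrite bformC // /bform -/c !mxE mulr_sumr; apply: eq_bigr => j _.
have -> : Q^T j i = z 0 j * s 0 j by rewrite [z 0 j]mxE divfK ?gt_eqF // !mxE.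
rewrite mxE -mulrA [s 0 j * _]mulrCA -expr2 ss zr (rr j i) [x^T _ _]mxE.
have uw : w 0 j / w 0 j = 1 by rewrite divff ?gt_eqF.
transitivity (r i * (c 0 j * x 0 j) * (w 0 j / w 0 j)); first by lra.
by rewrite uw mulr1.
Qed.

End Signature.

(** * Directional derivatives *)

Section Derivatives.
Context {R : realType} {n : nat}.
Implicit Types (W S T : {set 'I_n}) (f g h : {mpoly R[n]}) (u v x : 'rV[R]_n).
Implicit Types (us vs : seq 'rV[R]_n).

Lemma homog_coeffP e f :
  reflect (forall mu, f@_mu != 0 -> mdeg mu = e) (f \is e.-homog).
Proof.
apply: (iffP (dhomogP _ _ _)) => hf mu; last by rewrite mcoeff_msupp; apply: hf.
by rewrite -mcoeff_msupp; apply: hf.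
Qed.

Lemma dderivDl u v f : dderiv (u + v) f = dderiv u f + dderiv v f.
Proof. by rewrite -big_split; apply: eq_bigr => i _; rewrite mxE scalerDl. Qed.

Lemma dderivZl a u f : dderiv (a *: u) f = a *: dderiv u f.
Proof. by rewrite scaler_sumr; apply: eq_bigr => i _; rewrite mxE scalerA. Qed.

Lemma dderiv_is_linear u : linear (dderiv u).
Proof.
move=> a f g; rewrite /dderiv scaler_sumr -big_split; apply: eq_bigr => i _.
by rewrite mderivD mderivZ scalerDr !scalerA mulrC.
Qed.

HB.instance Definition _ u :=
  GRing.isLinear.Build R {mpoly R[n]} {mpoly R[n]} _ (dderiv u) (dderiv_is_linear u).

Lemma dderiv_delta i f : dderiv (delta_mx 0 i) f = f^`M(i).
Proof.
rewrite /dderiv (bigD1 i) //= mxE !eqxx scale1r big1 ?addr0 // => j ji.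
by rewrite mxE (negPf ji) andbF scale0r.
Qed.

Lemma dderiv_mderivm u m f : (dderiv u f)^`M[m] = dderiv u f^`M[m].
Proof.
rewrite /dderiv raddf_sum; apply: eq_bigr => i _ /=.
by rewrite mderivmZ -!mderivmU1m -!mderivmDm addmC.
Qed.

Lemma dderiv_mderiv u i f : (dderiv u f)^`M(i) = dderiv u f^`M(i).
Proof. by rewrite -!mderivmU1m dderiv_mderivm. Qed.

Lemma dderivC u v f : dderiv u (dderiv v f) = dderiv v (dderiv u f).
Proof.
rewrite [LHS]/dderiv [X in _ = dderiv _ X]/dderiv raddf_sum /=.
by apply: eq_bigr => i _; rewrite linearZ /= dderiv_mderiv.
Qed.

Lemma dderivs_dderiv vs u f : dderivs vs (dderiv u f) = dderiv u (dderivs vs f).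
Proof. by elim: vs => //= v vs ->; rewrite dderivC. Qed.

Lemma dderivs_is_linear vs : linear (dderivs vs).
Proof. by elim: vs => [|v vs IH] a f g //=; rewrite IH linearP. Qed.

HB.instance Definition _ vs :=
  GRing.isLinear.Build R {mpoly R[n]} {mpoly R[n]} _ (dderivs vs) (dderivs_is_linear vs).

Lemma dderivs_mderiv vs i f : (dderivs vs f)^`M(i) = dderivs vs f^`M(i).
Proof. by elim: vs => //= v vs <-; rewrite dderiv_mderiv. Qed.

Lemma sderiv1 i f : sderiv [set i] f = f^`M(i).
Proof. by rewrite /sderiv mesym1_set1 mderivmU1m. Qed.

Lemma sderiv0 f : sderiv set0 f = f.
Proof. by rewrite /sderiv mesym1_set0 mderivm0m. Qed.

Lemma mesym1U S T : [disjoint S & T] ->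
  mesym1 (S :|: T) = (mesym1 S + mesym1 T)%MM.
Proof.
move=> dST; apply/mnmP=> i; rewrite mnmDE !mnmE inE.
by have [iS|//] := boolP (i \in S); rewrite (disjointFr dST iS).
Qed.

Lemma sderivU S T f : [disjoint S & T] -> sderiv (S :|: T) f = sderiv T (sderiv S f).
Proof. by move=> dST; rewrite /sderiv mesym1U // mderivmDm. Qed.

Lemma sderivU1 i S f : i \notin S -> sderiv (i |: S) f = (sderiv S f)^`M(i).
Proof. by move=> iS; rewrite setUC sderivU ?sderiv1 // disjoint_sym disjoints1. Qed.

Lemma mderiv_homog e i f : f \is e.+1.-homog -> f^`M(i) \is e.-homog.
Proof.
move=> /homog_coeffP hf; apply/homog_coeffP => mu; rewrite mcoeff_mderiv.
rewrite mulrn_eq0 /= => /hf; rewrite mdegD mdeg1 addn1 => -[].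
by [].
Qed.

Lemma sderiv_homog e S f : f \is e.-homog -> sderiv S f \is (e - #|S|)%N.-homog.
Proof.
move=> /homog_coeffP hf; apply/homog_coeffP => mu; rewrite mcoeff_mderivm mulrn_eq0 negb_or.
by move=> /andP[_ /hf <-]; rewrite mdegD mdeg_mesym1 addKn.
Qed.

Lemma sderiv_card e S f : f \is e.-homog -> sderiv S f != 0 -> (#|S| <= e)%N.
Proof.
move=> /homog_coeffP hf; rewrite -msupp_eq0; case E: (msupp _) => [//|mu s] _.
have : mu \in msupp (sderiv S f) by rewrite E mem_head.
rewrite mcoeff_msupp mcoeff_mderivm mulrn_eq0 negb_or.
by move=> /andP[_ /hf <-]; rewrite mdegD mdeg_mesym1 leq_addr.
Qed.

Lemma homog0_const f : f \is 0.-homog -> f = (f@_0%MM)%:MP.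
Proof.
move=> /homog_coeffP hf; apply/mpolyP => mu; rewrite mcoeffC.
have [->|mu0] := eqVneq mu 0%MM; first by rewrite mulr1.
rewrite mulr0; apply/eqP; rewrite -[_ == 0]negbK; apply/negP => /hf/eqP.
by rewrite mdeg_eq0 (negPf mu0).
Qed.

(** A monomial of positive degree involves some variable, and in characteristic 0 the derivative
    along it keeps the coefficient nonzero. *)
Lemma homog_mderiv_eq0 e f : f \is e.+1.-homog -> (forall i, f^`M(i) = 0) -> f = 0.
Proof.
move=> /homog_coeffP hf h0; apply/mpolyP => mu; rewrite mcoeff0.
apply/eqP; rewrite -[_ == 0]negbK; apply/negP => fmu.
have := hf _ fmu; have [->|/eqP mu0] := eqVneq mu 0%MM; first by rewrite mdeg0.
move=> _; have /existsP[i mui] : [exists i, mu i != 0%N].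
  rewrite -negb_forall; apply/negP => /forallP mu0'; apply: mu0.
  by apply/mnmP => i; rewrite mnm0E; apply/eqP.
have := congr1 (mcoeff (mu - U_(i))%MM) (h0 i).
rewrite mcoeff_mderiv submK ?mcoeff0; last first.
  by apply/mnm_lepP => j; rewrite mnm1E; case: eqP => // <-; rewrite lt0n.
by move/eqP; rewrite mulrn_eq0 /= (negPf fmu).
Qed.

(** Brings the degree one clause of [lor_cone], stated by evaluation, to the form of a constant term
    of a derivative used in all other degrees. *)
Lemma homog1_eval f v : f \is 1.-homog -> f.@[v 0] = (dderiv v f)@_0%MM.
Proof.
move=> hf.
have -> : f = \sum_i (f^`M(i))@_0%MM *: 'X_i.
  apply/mpolyP => mu; rewrite raddf_sum /=.
  have [/mdeg1P[i /eqP ->]|mu1] := boolP (mdeg mu == 1%N).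
    rewrite (bigD1 i) //= mcoeffZ mcoeffXU eqxx mulr1 big1 ?addr0 => [|j ji].
      by rewrite mcoeff_mderiv add0m mnm0E mulr1n.
    by rewrite mcoeffZ mcoeffXU (negPf ji) mulr0.
  rewrite big1 => [|i _].
    by apply/eqP; rewrite -[_ == 0]negbK; apply/negP => /(homog_coeffP _ _ hf)/eqP; rewrite (negPf mu1).
  by rewrite mcoeffZ mcoeffX; case: (U_(i)%MM =P mu) mu1 => [<-|_ _]; rewrite ?mdeg1 ?mulr0.
rewrite [LHS]raddf_sum [dderiv v _]raddf_sum [RHS]raddf_sum /=; apply: eq_bigr => i _.
rewrite mevalZ mevalXU linearZ /= mcoeffZ; congr (_ * _).
rewrite raddf_sum /= (bigD1 i) //= big1 ?addr0 => [|j ji].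
  by rewrite mcoeffZ mcoeff_mderiv add0m mcoeffXU eqxx mnm0E mulr1n mulr1.
by rewrite mcoeffZ mcoeff_mderiv add0m mcoeffXU eq_sym (negPf ji) mul0rn mulr0.
Qed.

(** The substitution part of [link_poly], separated from the differentiation so that each can be
    moved past other operators. *)
Definition zsub S f : {mpoly R[n]} :=
  f \mPo [tuple (if i \in S then 0 else 'X_i) | i < n].

Lemma link_polyE S f : link_poly S f = zsub S (sderiv S f).
Proof. by []. Qed.

(** Reduces the commutation rules for [zsub] to comparisons of exponents. *)
Lemma mcoeff_zsub S f mu :
  (zsub S f)@_mu = if [forall i in S, mu i == 0%N] then f@_mu else 0.
Proof.
have XE nu : 'X_[nu] \mPo [tuple (if i \in S then 0 else 'X_i : {mpoly R[n]}) | i < n] =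
    if [forall i in S, nu i == 0%N] then 'X_[nu] else 0.
  rewrite comp_mpolyX; case: ifPn => [/forall_inP nu0|].
    rewrite mpolyXE_id; apply: eq_bigr => i _; rewrite tnth_mktuple.
    by case: ifPn => // /nu0/eqP ->; rewrite !expr0.
  rewrite negb_forall => /existsP[i]; rewrite negb_imply => /andP[iS nui].
  by rewrite (bigD1 i) //= tnth_mktuple iS expr0n (negPf nui) mul0r.
rewrite /zsub comp_mpolyEX raddf_sum /=.
rewrite [in RHS](mpolyE f) raddf_sum /=; case: ifPn => hmu.
  apply: eq_bigr => nu _; rewrite XE !mcoeffZ; case: ifPn => // hnu.
  by rewrite mcoeff0 mcoeffX; case: eqP hnu => [->|_]; rewrite ?hmu.
apply: big1 => nu _; rewrite XE mcoeffZ; case: ifPn => hnu; last by rewrite mcoeff0 mulr0.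
by rewrite mcoeffX; case: eqP hnu => [->|_]; rewrite ?(negPf hmu) // mulr0.
Qed.

Lemma zsub_is_linear S : linear (zsub S).
Proof. by move=> a f g; rewrite /zsub comp_mpolyD comp_mpolyZ. Qed.

HB.instance Definition _ S :=
  GRing.isLinear.Build R {mpoly R[n]} {mpoly R[n]} _ (zsub S) (zsub_is_linear S).

Lemma zsub_mderiv S i f : i \notin S -> (zsub S f)^`M(i) = zsub S f^`M(i).
Proof.
move=> iS; apply/mpolyP => mu; rewrite mcoeff_mderiv !mcoeff_zsub mcoeff_mderiv.
rewrite (_ : [forall j in S, _] = [forall j in S, mu j == 0%N]); last first.
  apply: eq_forallb_in => j jS; rewrite mnmDE mnm1E.
  by case: (i =P j) jS iS => [-> -> //|_ _ _]; rewrite addn0.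
by case: ifP => // _; rewrite mul0rn.
Qed.

Lemma zsub_mderiv0 S i f : i \in S -> (zsub S f)^`M(i) = 0.
Proof.
move=> iS; apply/mpolyP => mu; rewrite mcoeff_mderiv mcoeff_zsub mcoeff0.
case: ifPn => [/forall_inP/(_ i iS)|_]; last by rewrite mul0rn.
by rewrite mnmDE mnm1E eqxx addn1.
Qed.

Lemma zsub_sderiv S T f : [disjoint T & S] -> sderiv T (zsub S f) = zsub S (sderiv T f).
Proof.
move=> dTS; apply/mpolyP => mu; rewrite mcoeff_mderivm !mcoeff_zsub mcoeff_mderivm.
rewrite (_ : [forall j in S, _] = [forall j in S, mu j == 0%N]); last first.
  apply: eq_forallb_in => j jS; rewrite mnmDE mnmE.
  by rewrite (disjointFl dTS jS).
by case: ifP => // _; rewrite mul0rn.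
Qed.

Lemma zsub_homog e S f : f \is e.-homog -> zsub S f \is e.-homog.
Proof.
move=> /homog_coeffP hf; apply/homog_coeffP => mu; rewrite mcoeff_zsub.
by case: ifP => _; [apply: hf | rewrite eqxx].
Qed.

Lemma zsub_coeff0 S f : (zsub S f)@_0%MM = f@_0%MM.
Proof.
by rewrite mcoeff_zsub; case: ifPn => // /forall_inP[] i _; rewrite mnm0E.
Qed.

Lemma zsub_zsub S T f : zsub T (zsub S f) = zsub (S :|: T) f.
Proof.
apply/mpolyP => mu; rewrite !mcoeff_zsub.
have -> : [forall i in S :|: T, mu i == 0%N] =
    [forall i in T, mu i == 0%N] && [forall i in S, mu i == 0%N].
  apply/forall_inP/andP => [h|[/forall_inP hT /forall_inP hS] i].
    by split; apply/forall_inP => i iS; apply: h; rewrite inE iS ?orbT.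
  by rewrite inE => /orP[/hS|/hT].
by case: [forall i in T, _].
Qed.

Lemma zsub0 f : zsub set0 f = f.
Proof. by apply/mpolyP => mu; rewrite mcoeff_zsub; case: forall_inP => // -[] i; rewrite inE. Qed.

(* Modulo the operators [dderiv l], which kill [f], every partial derivative of
   [f] is a combination of those in directions outside [S]. *)
Lemma zsub_inj e (L : set 'rV[R]_n) S f : f \is e.-homog ->
  (forall l, L l -> dderiv l f = 0) ->
  (forall y : 'rV[R]_n, exists2 l, L l & forall i, i \in S -> l 0 i = y 0 i) ->
  zsub S f = 0 -> f = 0.
Proof.
move=> hf Lf hL; elim: e f hf Lf => [|e IH] f hf Lf f0.
  by rewrite (homog0_const hf) -(zsub_coeff0 S) f0 mcoeff0.
have dS j : j \notin S -> f^`M(j) = 0.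
  move=> jS; apply: IH; first exact: mderiv_homog.
    by move=> l Ll; rewrite -dderiv_mderiv Lf // linear0.
  by rewrite -zsub_mderiv // f0 linear0.
apply: (homog_mderiv_eq0 hf) => i; have [iS|] := boolP (i \in S); last exact: dS.
have [l Ll hl] := hL (delta_mx 0 i).
rewrite -(Lf l Ll) -dderiv_delta; apply: eq_bigr => j _.
by have [jS|jS] := boolP (j \in S); [rewrite hl | rewrite dS // !scaler0].
Qed.

End Derivatives.

(** * Strongly hereditary polynomials and their links *)

Section StronglyHereditary.
Context {R : realType} {n : nat}.
Implicit Types (W S T : {set 'I_n}) (f g h : {mpoly R[n]}) (u v x : 'rV[R]_n).
Implicit Types (us vs : seq 'rV[R]_n) (m : nat).

(* Unlike in [hereditary], facets are not removed from the complex: this holds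
   for volume polynomials and forces the complex to be pure. *)
Definition strongly_hereditary m W f :=
  [/\ f \is m.-homog, f != 0, (forall j, j \notin W -> f^`M(j) = 0)
    & hereditary_pair (poly_complex W f) (lin_space W f)].

Lemma link_linkE (D : {set {set 'I_n}}) S T : [disjoint T & S] ->
  link (link D S) T = link D (S :|: T).
Proof.
rewrite -setI_eq0 => dTS; apply/setP => X; rewrite !inE -!setI_eq0.
rewrite setIUr setIUl !setU_eq0 dTS setUA /=.
by case: (X :&: S == _); rewrite ?andbT ?andbF.
Qed.

Lemma sderivD S T f : T \subset S -> sderiv S f = sderiv (S :\: T) (sderiv T f).
Proof.
move=> TS; rewrite -sderivU; last first.
  by rewrite disjoints_subset; apply/subsetP => i iT; rewrite !inE iT.
by congr (sderiv _ f); apply/setP => i; rewrite !inE; case: (boolP (i \in T)) => // /(subsetP TS).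
Qed.

Section Fixed.
Variables (m : nat) (W : {set 'I_n}) (f : {mpoly R[n]}).
Hypothesis hf : strongly_hereditary m W f.
Local Notation D := (poly_complex W f).

(** The inclusion in [W] is automatic: differentiating along a variable outside [W] kills [f]. *)
Lemma mem_complex S : (S \in D) = (sderiv S f != 0).
Proof.
have [_ _ fW _] := hf; rewrite inE andb_idl // => Sf.
apply/subsetP => i iS; rewrite -[_ \in _]negbK; apply: contraNN Sf => /fW fi.
by rewrite (@sderivD _ [set i]) ?sub1set // sderiv1 fi /sderiv linear0.
Qed.

Lemma complex_down S T : T \subset S -> S \in D -> T \in D.
Proof.
move=> TS; rewrite !mem_complex; apply: contraNN => /eqP Tf.
by rewrite (sderivD _ TS) Tf /sderiv linear0.
Qed.

Lemma complex0 : finset.set0 \in D.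
Proof. by have [_ f0 _ _] := hf; rewrite mem_complex sderiv0. Qed.

Lemma complex_card S : S \in D -> (#|S| <= m)%N.
Proof. by have [fm _ _ _] := hf; rewrite mem_complex; apply: sderiv_card. Qed.

Lemma lin_sderiv S l : lin_space W f l -> dderiv l (sderiv S f) = 0.
Proof. by move=> [_ lf]; rewrite /sderiv -dderiv_mderivm lf linear0. Qed.

(** Purity. If [S] did not extend, [sderiv S f] would have zero partial derivatives outside [S].
    Interpolation on [S] by elements of the lineality space then kills those inside [S] too, and
    [sderiv S f], of positive degree, would vanish. *)
Lemma complex_extend S : S \in D -> (#|S| < m)%N ->
  exists2 i, i \notin S & i |: S \in D.
Proof.
have [fm _ _ fD] := hf; move=> SD Sm.
have [/existsP[i /andP[iS iD]]|] := boolP [exists i, (i \notin S) && (i |: S \in D)].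
  by exists i.
rewrite negb_exists => /forallP nS; suff : sderiv S f = 0.
  by move: SD; rewrite mem_complex => /eqP.
have dS j : j \notin S -> (sderiv S f)^`M(j) = 0.
  by move=> jS; have := nS j; rewrite jS mem_complex negbK sderivU1 // => /eqP.
have mE : (m - #|S| = (m - #|S|).-1.+1)%N by rewrite prednK // subn_gt0.
have := sderiv_homog S fm; rewrite mE => /homog_mderiv_eq0; apply=> i.
have [iS|] := boolP (i \in S); last exact: dS.
have [l Ll hl] := fD S SD (delta_mx 0 i).
rewrite -(lin_sderiv S Ll) -dderiv_delta; apply: eq_bigr => j _.
by have [jS|jS] := boolP (j \in S); [rewrite hl | rewrite dS // !scaler0].
Qed.

Lemma in_link_vars S j : (j \in link_vars W f S) = (j \notin S) && (j |: S \in D).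
Proof. by rewrite !inE disjoints1 setUC. Qed.

Lemma sderiv_link_vars S j : j \notin S -> j \notin link_vars W f S ->
  (sderiv S f)^`M(j) = 0.
Proof.
by move=> jS; rewrite in_link_vars jS mem_complex negbK sderivU1 // => /eqP.
Qed.

Lemma zsub_dderiv_restrict S u g : (forall i, i \in S -> u 0 i = 0) ->
  (forall j, j \notin S -> j \notin link_vars W f S -> g^`M(j) = 0) ->
  dderiv (restrict (link_vars W f S) u) (zsub S g) = zsub S (dderiv u g).
Proof.
move=> uS gS; rewrite /dderiv raddf_sum /=; apply: eq_bigr => j _.
rewrite linearZ /= mxE; have [jS|jS] := boolP (j \in S).
  by rewrite uS // !scale0r zsub_mderiv0 // scaler0.
by case: ifPn => jV; rewrite zsub_mderiv // gS // linear0 !scaler0.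
Qed.

Lemma zsub_complex_inj S e g : S \in D -> g \is e.-homog ->
  (forall l, lin_space W f l -> dderiv l g = 0) -> zsub S g = 0 -> g = 0.
Proof.
have [_ _ _ fD] := hf => SD ge gL; apply: (zsub_inj ge gL) => y.
by have [l] := fD S SD y; exists l.
Qed.

(** Setting the variables of [S] to 0 could a priori kill further derivatives; [zsub_complex_inj]
    excludes this. *)
Lemma link_complex S : S \in D ->
  poly_complex (link_vars W f S) (link_poly S f) = link D S.
Proof.
move=> SD; apply/setP => T; rewrite inE [in RHS]inE link_polyE.
have [dTS|dTS] := boolP [disjoint T & S]; last first.
  apply: contraNF dTS => /andP[/subsetP TV _]; rewrite disjoints_subset.
  by apply/subsetP => i /TV; rewrite in_link_vars => /andP[iS _]; rewrite inE.
rewrite zsub_sderiv // mem_complex sderivU 1?disjoint_sym //=.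
have [->|nz] := eqVneq (sderiv T (sderiv S f)) 0; first by rewrite linear0 eqxx andbF.
have [fm _ _ _] := hf.
apply/andP; split; last first.
  apply: contra_neq nz; apply: (zsub_complex_inj SD).
    exact/sderiv_homog/sderiv_homog/fm.
  by move=> l Ll; rewrite /sderiv -!dderiv_mderivm; case: Ll => _ ->; rewrite !linear0.
apply/subsetP => i iT; rewrite in_link_vars (disjointFr dTS iT) /=.
apply: (@complex_down (S :|: T)).
  by apply/subsetP => j; rewrite !inE => /orP[/eqP ->|->//]; rewrite iT orbT.
by rewrite mem_complex sderivU // disjoint_sym.
Qed.

(** To interpolate values on a face [T] of the link, they are extended by 0 to [S] and interpolated
    on the face [S :|: T]. The resulting element vanishes on [S], so its restriction lies in the
    lineality space of the link. *)
Lemma link_strongly_hereditary S : S \in D ->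
  strongly_hereditary (m - #|S|) (link_vars W f S) (link_poly S f).
Proof.
move=> SD; have [fm _ _ fD] := hf; split.
- by rewrite link_polyE; apply/zsub_homog/sderiv_homog.
- have := SD; rewrite mem_complex link_polyE; apply: contra_neq.
  apply: (zsub_complex_inj SD (sderiv_homog S fm)); exact: lin_sderiv.
- move=> j jV; rewrite link_polyE; have [jS|jS] := boolP (j \in S).
    exact: zsub_mderiv0.
  by rewrite zsub_mderiv // sderiv_link_vars // linear0.
move=> T; rewrite link_complex // inE => /andP[dTS STD] y.
have [l Ll hl] := fD _ STD (restrict T y).
have lS i : i \in S -> l 0 i = 0.
  by move=> iS; rewrite hl ?inE ?iS // mxE (disjointFl dTS iS).
exists (restrict (link_vars W f S) l).
  split; first by move=> i iV; rewrite mxE (negPf iV).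
  rewrite link_polyE zsub_dderiv_restrict ?lin_sderiv ?linear0 //.
  exact: sderiv_link_vars.
move=> i iT; rewrite mxE in_link_vars (disjointFr dTS iT) /=.
rewrite (@complex_down (S :|: T)) //; last first.
  by apply/subsetP => j; rewrite !inE => /orP[/eqP ->|->//]; rewrite iT orbT.
by rewrite hl ?inE ?iT ?orbT // mxE iT.
Qed.

Lemma link_poly_link S T : [disjoint T & S] ->
  link_poly T (link_poly S f) = link_poly (S :|: T) f.
Proof.
move=> dTS; rewrite !link_polyE zsub_sderiv // zsub_zsub sderivU //.
by rewrite disjoint_sym.
Qed.

Lemma link_vars_link S T : S \in D -> [disjoint T & S] ->
  link_vars (link_vars W f S) (link_poly S f) T = link_vars W f (S :|: T).
Proof. by move=> SD dTS; rewrite /link_vars link_complex // link_linkE. Qed.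

(** On a face, interpolation makes the specification satisfiable, so the default value 0 of [xget]
    is not the one returned. *)
Lemma dual_vecP S i : S \in D -> i \in S ->
  [/\ lin_space W f (dual_vec W f S i), dual_vec W f S i 0 i = 1
    & forall j, j \in S -> j != i -> dual_vec W f S i 0 j = 0].
Proof.
move=> SD iS; have [_ _ _ fD] := hf.
have [l Ll hl] := fD S SD (delta_mx 0 i).
apply: (@xgetPex _ 0 [set l | [/\ lin_space W f l, l 0 i = 1 &
                      forall j, j \in S -> j != i -> l 0 j = 0]]%classic).
exists l; split=> //; first by rewrite hl // mxE !eqxx.
by move=> j jS ji; rewrite hl // mxE (negPf ji) andbF.
Qed.

(** The subtracted dual vectors kill [g], and what remains of [v] is zero on [S]. Hence the
    derivative is the same for every choice of dual vectors. *)
Lemma zsub_dderiv_link_proj S v g : S \in D ->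
  (forall l, lin_space W f l -> dderiv l g = 0) ->
  (forall j, j \notin S -> j \notin link_vars W f S -> g^`M(j) = 0) ->
  dderiv (link_proj W f S v) (zsub S g) = zsub S (dderiv v g).
Proof.
move=> SD gL gS; rewrite /link_proj zsub_dderiv_restrict //.
  congr zsub; rewrite -scaleN1r dderivDl dderivZl.
  suff -> : dderiv (\sum_(i in S) v 0 i *: dual_vec W f S i) g = 0 by rewrite scaler0 addr0.
  apply: (big_ind (fun u => dderiv u g = 0)).
  - by rewrite -(scale0r (0 : 'rV[R]_n)) dderivZl scale0r.
  - by move=> u1 u2 h1 h2; rewrite dderivDl h1 h2 addr0.
  by move=> i iS; rewrite dderivZl gL ?scaler0 //; case: (dual_vecP SD iS).
move=> i iS; rewrite !mxE summxE (bigD1 i) //= big1 ?addr0 => [|j /andP[jS ji]].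
  by rewrite mxE; case: (dual_vecP SD iS) => _ -> _; rewrite mulr1 subrr.
by rewrite mxE; case: (dual_vecP SD jS) => _ _ ->; rewrite ?mulr0 // eq_sym.
Qed.

Lemma link_poly_dderiv S v : S \in D ->
  dderiv (link_proj W f S v) (link_poly S f) = zsub S (dderiv v (sderiv S f)).
Proof.
move=> SD; apply: zsub_dderiv_link_proj => //; first exact: lin_sderiv.
exact: sderiv_link_vars.
Qed.

Lemma zsub_dderivs_link_proj S vs g : S \in D ->
  (forall l, lin_space W f l -> dderiv l g = 0) ->
  (forall j, j \notin S -> j \notin link_vars W f S -> g^`M(j) = 0) ->
  dderivs (map (link_proj W f S) vs) (zsub S g) = zsub S (dderivs vs g).
Proof.
move=> SD gL gS; elim: vs => //= v vs ->; rewrite zsub_dderiv_link_proj //.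
  by move=> l Ll; rewrite -dderivs_dderiv gL // linear0.
by move=> j jS jV; rewrite dderivs_mderiv gS // linear0.
Qed.

(** Constant terms survive the substitution, so polarizations of a link can be computed as
    polarizations of a derivative of [f], with unprojected directions. *)
Lemma link_dderivs_coeff S vs : S \in D ->
  (dderivs (map (link_proj W f S) vs) (link_poly S f))@_0%MM =
  (dderivs vs (sderiv S f))@_0%MM.
Proof.
move=> SD; rewrite link_polyE zsub_dderivs_link_proj ?zsub_coeff0 //.
  exact: lin_sderiv.
exact: sderiv_link_vars.
Qed.

End Fixed.
End StronglyHereditary.

(** * Cones and Hessians *)

Section Hessians.
Context {R : realType} {n : nat}.
Implicit Types (W : {set 'I_n}) (q : {mpoly R[n]}) (x y : 'rV[R]_n).

(** The constant term turns the second derivative into a scalar; for a quadratic [q] that derivative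
    is already constant. *)
Definition qform q x y : R := (dderiv x (dderiv y q))@_0%MM.

Definition coords W x : 'rV[R]_#|W| := \row_j x 0 (enum_val j).

Lemma qformC q x y : qform q x y = qform q y x.
Proof. by rewrite /qform dderivC. Qed.

Lemma dderiv_coeffE x q : (dderiv x q)@_0%MM = \sum_i x 0 i * (q^`M(i))@_0%MM.
Proof. by rewrite raddf_sum /=; apply: eq_bigr => i _; rewrite mcoeffZ. Qed.

Lemma dderiv_coeff_supported W x q : supported W x ->
  (dderiv x q)@_0%MM = \sum_(j < #|W|) coords W x 0 j * (q^`M(enum_val j))@_0%MM.
Proof.
move=> xW; rewrite dderiv_coeffE (bigID (mem W)) /= addrC big1 ?add0r; last first.
  by move=> i /xW ->; rewrite mul0r.
by rewrite big_enum_val; apply: eq_bigr => j _; rewrite mxE.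
Qed.

Lemma hessian_sym W q : (hessian W q)^T = hessian W q.
Proof. by apply/matrixP => i j; rewrite !mxE mderiv_comm. Qed.

Lemma coords_mulmx_hessian W q x j : supported W x ->
  (coords W x *m hessian W q) 0 j = (dderiv x q^`M(enum_val j))@_0%MM.
Proof.
move=> xW; rewrite (dderiv_coeff_supported _ xW) mxE; apply: eq_bigr => i _.
by rewrite [hessian _ _ _ _]mxE mderiv_comm.
Qed.

Lemma bform_hessian W q x y : supported W x -> supported W y ->
  bform (hessian W q) (coords W x) (coords W y) = qform q x y.
Proof.
move=> xW yW; rewrite qformC /qform (dderiv_coeff_supported _ yW) /bform mxE.
by apply: eq_bigr => j _; rewrite coords_mulmx_hessian // mulrC mxE dderiv_mderiv.
Qed.

Lemma coords_surj W (a : 'rV[R]_#|W|) : exists2 x, supported W x & coords W x = a.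
Proof.
exists (\sum_j a 0 j *: delta_mx 0 (enum_val j)) => [i iW|].
  rewrite summxE big1 // => j _; rewrite !mxE eqxx /=.
  by case: eqP iW => [->|]; rewrite ?mulr0 // enum_valP.
apply/rowP => j; rewrite mxE summxE (bigD1 j) //= big1 => [|k kj].
  by rewrite !mxE !eqxx mulr1 addr0.
by rewrite !mxE (inj_eq enum_val_inj) eq_sym (negPf kj) andbF mulr0.
Qed.

Lemma hessian_at_most_one_CS W q x y : at_most_one_pos_eigenvalue (hessian W q) ->
  supported W x -> supported W y -> 0 < qform q y y ->
  qform q x x * qform q y y <= qform q x y ^+ 2.
Proof.
move=> hq xW yW; rewrite -!(@bform_hessian W) //.
exact/at_most_one_pos_CS/hq/hessian_sym.
Qed.

Lemma hessian_exactly_one W q y : supported W y -> 0 < qform q y y ->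
  (forall x, supported W x -> qform q x y = 0 -> qform q x x <= 0) ->
  exactly_one_pos_eigenvalue (hessian W q).
Proof.
move=> yW; rewrite -(@bform_hessian W) // => hy hx.
apply: (exactly_one_pos_intro (hessian_sym W q) hy) => a.
by have [x xW <-] := coords_surj a; rewrite !bform_hessian //; apply: hx.
Qed.

Lemma restrict_supported W x : supported W (restrict W x).
Proof. by move=> i iW; rewrite mxE (negPf iW). Qed.

Lemma dderiv_restrict W x q : (forall j, j \notin W -> q^`M(j) = 0) ->
  dderiv (restrict W x) q = dderiv x q.
Proof.
move=> qW; apply: eq_bigr => j _; rewrite mxE.
by case: ifPn => // /qW ->; rewrite !scaler0.
Qed.

End Hessians.

Arguments lor_cone : simpl never.

(** * Positivity on the cones of a strongly hereditary polynomial *)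

Section Cones.
Context {R : realType} {n : nat}.
Implicit Types (W S T : {set 'I_n}) (f g h : {mpoly R[n]}) (u v x : 'rV[R]_n).
Implicit Types (us vs : seq 'rV[R]_n) (m : nat).

Definition pos_plus_lin W f v :=
  exists p l, [/\ positive_on W p, lin_space W f l & v = p + l].

Definition vertex_set W f := vertices (poly_complex W f).

(** Starting at [m.+2] rules out the degree one clause, and the statement holds by computation. *)
Lemma lor_cone2 m W f v : lor_cone m.+2 W f v ->
  pos_plus_lin W f v /\ forall i, i \in vertex_set W f ->
    lor_cone m.+1 (link_vars W f [set i]) (link_poly [set i] f)
                  (link_proj W f [set i] v).
Proof. by []. Qed.

Lemma in_vertices (D : {set {set 'I_n}}) i : (i \in vertices D) = ([set i] \in D).
Proof. by rewrite inE. Qed.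

Section Fixed.
Variables (m : nat) (W : {set 'I_n}) (f : {mpoly R[n]}).
Hypothesis hf : strongly_hereditary m W f.
Local Notation D := (poly_complex W f).
Local Notation V0 := (vertex_set W f).

Lemma mem_vertex_set i : (i \in V0) = (f^`M(i) != 0).
Proof. by rewrite in_vertices (mem_complex hf) sderiv1. Qed.

Lemma vertex_set_sub : V0 \subset W.
Proof.
by apply/subsetP => i; rewrite in_vertices inE sub1set => /andP[].
Qed.

Lemma vertex_link i : i \in V0 ->
  strongly_hereditary m.-1 (link_vars W f [set i]) (link_poly [set i] f).
Proof.
by rewrite in_vertices => iD; have := link_strongly_hereditary hf iD; rewrite cards1 subn1.
Qed.

Lemma vertex_coeff vs i : i \in V0 ->
  (dderivs (map (link_proj W f [set i]) vs) (link_poly [set i] f))@_0%MM =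
  (dderivs vs f^`M(i))@_0%MM.
Proof. by rewrite in_vertices => iD; rewrite (link_dderivs_coeff hf) // sderiv1. Qed.

Lemma vertex_exists : (0 < m)%N -> exists i, i \in V0.
Proof.
move=> m0; have [|i _] := complex_extend hf (complex0 hf); first by rewrite cards0.
by rewrite setU0 => iD; exists i; rewrite in_vertices.
Qed.

(** Properties inherited by all iterated derivatives of [f]. On such a [g], a direction [p + l] with
    [l] in the lineality space acts as the restriction of [p] to the vertices. *)
Definition admissible g :=
  (forall l, lin_space W f l -> dderiv l g = 0) /\
  (forall j, j \notin V0 -> g^`M(j) = 0).

Lemma admissible_self : admissible f.
Proof.
by split=> [l []//|j]; rewrite mem_vertex_set negbK => /eqP.
Qed.

Lemma admissible_mderiv i g : admissible g -> admissible g^`M(i).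
Proof.
move=> [gL gV]; split=> [l Ll|j jV]; first by rewrite -dderiv_mderiv gL // linear0.
by rewrite mderiv_comm gV // linear0.
Qed.

Lemma admissible_dderiv u g : admissible g -> admissible (dderiv u g).
Proof.
move=> [gL gV]; split=> [l Ll|j jV]; first by rewrite dderivC gL // linear0.
by rewrite dderiv_mderiv gV // linear0.
Qed.

Lemma admissible_dderivs us g : admissible g -> admissible (dderivs us g).
Proof. by move=> ag; elim: us => //= u us IH; apply: admissible_dderiv. Qed.

Lemma admissible_pos_part p l g : admissible g -> lin_space W f l ->
  dderiv (restrict V0 p) g = dderiv (p + l) g.
Proof.
by move=> [gL gV] Ll; rewrite dderiv_restrict // dderivDl (gL l) // addr0.
Qed.

End Fixed.

(** Induction on the degree: the positive part of the first direction expands the polarization as a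
    positive combination of polarizations of vertex links. Strictness comes from the existence of a
    vertex. *)
Lemma lor_cone_pos m W f vs : strongly_hereditary m.+1 W f ->
  size vs = m.+1 -> (forall v, v \in vs -> lor_cone m.+1 W f v) ->
  0 < (dderivs vs f)@_0%MM.
Proof.
elim: m W f vs => [|m IH] W f [|v vs] //= hf [sz] hv.
  case: vs sz hv => // _ hv; have [_ ] := hv v (mem_head _ _).
  by rewrite homog1_eval //; case: hf.
have [[p [l [[_ p0] Ll vE]] _]] := lor_cone2 (hv v (mem_head _ _)).
rewrite vE -(admissible_pos_part p (admissible_dderivs _ (admissible_self hf)) Ll).
have pos i : i \in vertex_set W f -> 0 < (dderivs vs f^`M(i))@_0%MM.
  move=> iV; rewrite -(vertex_coeff hf) //; apply: IH; first exact: (vertex_link hf).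
    by rewrite size_map.
  move=> _ /mapP[u uvs ->]; have [|_] := @lor_cone2 m W f u; last exact.
  by apply: hv; rewrite inE uvs orbT.
have [i0 i0V] := vertex_exists hf (ltn0Sn _).
have posW i : i \in vertex_set W f -> 0 < p 0 i by move/(subsetP (vertex_set_sub W f)); apply: p0.
rewrite dderiv_coeffE (bigD1 i0) //= ltr_pwDl //.
  by rewrite mxE i0V dderivs_mderiv mulr_gt0 // ?posW ?pos.
apply: sumr_ge0 => i _; rewrite mxE; case: ifPn => iV; last by rewrite mul0r.
by rewrite dderivs_mderiv mulr_ge0 // ltW // ?posW ?pos.
Qed.

Lemma lor_cone_vertex_pos m W f vs i : strongly_hereditary m.+2 W f ->
  i \in vertex_set W f ->
  size vs = m.+1 -> (forall v, v \in vs -> lor_cone m.+2 W f v) ->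
  0 < (dderivs vs f^`M(i))@_0%MM.
Proof.
move=> hf iV sz hv; rewrite -(vertex_coeff hf) //.
apply: (lor_cone_pos (vertex_link hf iV)); first by rewrite size_map.
by move=> _ /mapP[u uvs ->]; have [|_] := @lor_cone2 m W f u; [apply: hv | apply].
Qed.

(** Vertex positivity, applied to the vertex [j] of the link of [i]. It makes the Hessian entries of
    edges positive. *)
Lemma lor_cone_edge_pos m W f vs i j : strongly_hereditary m.+3 W f ->
  i != j -> [set i; j] \in poly_complex W f ->
  size vs = m.+1 -> (forall v, v \in vs -> lor_cone m.+3 W f v) ->
  0 < (dderivs vs f^`M(i)^`M(j))@_0%MM.
Proof.
move=> hf ij ijD sz hv.
have iV : i \in vertex_set W f.
  by rewrite in_vertices (complex_down hf _ ijD) // sub1set !inE eqxx.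
have iD : [set i] \in poly_complex W f by rewrite -in_vertices.
have ji : [disjoint [set j] & [set i]] by rewrite disjoints1 inE eq_sym.
have jV : j \in vertex_set (link_vars W f [set i]) (link_poly [set i] f).
  by rewrite in_vertices (link_complex hf) // inE ji.
have -> : (dderivs vs f^`M(i)^`M(j))@_0%MM =
    (dderivs (map (link_proj W f [set i]) vs) (link_poly [set i] f)^`M(j))@_0%MM.
  rewrite link_polyE zsub_mderiv ?inE 1?eq_sym // (zsub_dderivs_link_proj hf) //.
  - by rewrite zsub_coeff0 sderiv1.
  - by move=> l Ll; rewrite -dderiv_mderiv (lin_sderiv _ Ll) linear0.
  by move=> k kS kV; rewrite mderiv_comm (sderiv_link_vars hf) // linear0.
apply: (lor_cone_vertex_pos (vertex_link hf iV)) => //; first by rewrite size_map.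
by move=> _ /mapP[u uvs ->]; have [|_] := @lor_cone2 m.+1 W f u; [apply: hv | apply].
Qed.

End Cones.

(** * From links to the whole complex *)

Section LocalToGlobal.
Context {R : realType} {n : nat}.
Implicit Types (W S T : {set 'I_n}) (f g h q : {mpoly R[n]}) (u v x : 'rV[R]_n).
Implicit Types (us vs : seq 'rV[R]_n) (m : nat).

Lemma link0E (D : {set {set 'I_n}}) : link D finset.set0 = D.
Proof. by apply/setP => T; rewrite inE set0U -setI_eq0 setI0 eqxx. Qed.

(** Translates connectedness of the 1-skeleton into the form asked by [trickle_down], with indices
    in the enumeration of the vertices. *)
Lemma connected_constant (D : {set {set 'I_n}}) (A : Type) (r : 'I_#|vertices D| -> A) :
  (forall S T, T \subset S -> S \in D -> T \in D) ->
  complex_connected D ->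
  (forall i j, i != j -> [set enum_val i; enum_val j] \in D -> r i = r j) ->
  forall i j, r i = r j.
Proof.
move=> downD connD hr i j.
have /connectP[p] := connD _ _ (enum_valP i) (enum_valP j).
elim: p i => [|a p IH] i /= => [_ /enum_val_inj -> //|/andP[ia pa] ja].
have aV : a \in vertices D by rewrite in_vertices (downD _ _ _ ia) // sub1set !inE eqxx orbT.
have [k ak] : exists k : 'I_#|vertices D|, a = enum_val k.
  by exists (enum_rank_in aV a); rewrite (enum_rankK_in aV aV).
rewrite ak in ia pa ja; transitivity (r k); last exact: IH.
(* The relation has loops, since [[set a; a]] is the singleton of [a]; a path may thus stay in
   place. *)
by have [->//|ik] := eqVneq i k; apply: hr.
Qed.

(** The reverse Cauchy-Schwarz inequality of the link of [i], read on the partial derivative of [f]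
    because the polarizations agree. *)
Lemma K_Lorentzian_vertex m W f vs i x y : strongly_hereditary m.+3 W f ->
  i \in vertex_set W f ->
  K_Lorentzian (lor_cone m.+2 (link_vars W f [set i]) (link_poly [set i] f))
    m.+2 (link_vars W f [set i]) (link_poly [set i] f) ->
  size vs = m -> (forall v, v \in vs -> lor_cone m.+3 W f v) ->
  lor_cone m.+3 W f y ->
  qform (dderivs vs f^`M(i)) x x * qform (dderivs vs f^`M(i)) y y <=
  qform (dderivs vs f^`M(i)) x y ^+ 2.
Proof.
move=> hf iV [_ hL] sz hv hy.
have qE a b : qform (dderivs vs f^`M(i)) a b =
    qform (dderivs (map (link_proj W f [set i]) vs) (link_poly [set i] f))
      (link_proj W f [set i] a) (link_proj W f [set i] b).
  exact: esym (vertex_coeff hf [:: a, b & vs] iV).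
have hpi v : lor_cone m.+3 W f v ->
    lor_cone m.+2 (link_vars W f [set i]) (link_poly [set i] f) (link_proj W f [set i] v).
  by move=> hv'; have [|_] := @lor_cone2 R n m.+1 W f v; [exact: hv' | apply].
set pi := link_proj W f [set i].
have [||_ h1] := hL [:: pi y, pi y & map pi vs].
- by rewrite /= size_map sz.
- move=> v; rewrite !inE => /or3P[/eqP ->|/eqP ->|/mapP[u uvs ->]]; first exact: hpi.
    exact: hpi.
  exact/hpi/hv.
rewrite !qE; apply: (@hessian_at_most_one_CS R n (link_vars W f [set i])).
- by have /exactly_one_pos_at_most := h1 isT; rewrite /= drop0.
- exact: restrict_supported.
- exact: restrict_supported.
rewrite -qE; apply: (lor_cone_vertex_pos hf iV (vs := [:: y, y & vs])).
  by rewrite /= sz.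
by move=> v; rewrite !inE => /or3P[/eqP ->|/eqP ->|/hv].
Qed.

(** The trickling-down step: [trickle_down] is applied to the Hessian on the vertices, with the
    positive part of a cone direction as weight vector. *)
Lemma connected_exactly_one m W f vs : strongly_hereditary m.+3 W f ->
  complex_connected (poly_complex W f) ->
  (forall i, i \in vertex_set W f ->
    K_Lorentzian (lor_cone m.+2 (link_vars W f [set i]) (link_poly [set i] f))
      m.+2 (link_vars W f [set i]) (link_poly [set i] f)) ->
  size vs = m.+1 -> (forall v, v \in vs -> lor_cone m.+3 W f v) ->
  exactly_one_pos_eigenvalue (hessian W (dderivs vs f)).
Proof.
move=> hf conn hL; case: vs => [//|v rest] /= [sz] hv.
have hvv : lor_cone m.+3 W f v by apply: hv; rewrite mem_head.
have hrest u : u \in rest -> lor_cone m.+3 W f u by move=> ur; apply: hv; rewrite inE ur orbT.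
set g := dderivs rest f; set q := dderiv v g; pose V0 := vertex_set W f.
have [[p [l [[_ p0] Ll vE]]] _] := lor_cone2 hvv.
have ag : admissible W f g := admissible_dderivs _ (admissible_self hf).
have aq : admissible W f q := admissible_dderiv _ ag.
(* [P] has positive coordinates at the vertices and acts as [v] on every admissible polynomial. *)
pose P := restrict V0 p.
have PV : supported V0 P := @restrict_supported _ _ _ _.
have PE h : admissible W f h -> dderiv P h = dderiv v h.
  by move=> ah; rewrite /P (admissible_pos_part p ah Ll) vE.
have hres x h : admissible W f h -> dderiv (restrict V0 x) h = dderiv x h.
  by move=> [_ hV]; apply: dderiv_restrict.
pose H := hessian V0 q; pose w := coords V0 P.
have w0 i : 0 < w 0 i.
  by rewrite !mxE enum_valP; apply: p0; apply: (subsetP (vertex_set_sub W f)); apply: enum_valP.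
have gE (i : 'I_#|V0|) : g^`M(enum_val i) = dderivs rest f^`M(enum_val i).
  by rewrite dderivs_mderiv.
have cE i : (w *m H) 0 i = qform (dderivs rest f^`M(enum_val i)) v v.
  rewrite coords_mulmx_hessian // PE; last exact: admissible_mderiv.
  by rewrite dderiv_mderiv gE.
have c0 i : 0 < (w *m H) 0 i.
  rewrite cE; apply: (lor_cone_vertex_pos hf (enum_valP i) (vs := [:: v, v & rest])).
    by rewrite /= sz.
  by move=> u; rewrite !inE => /or3P[/eqP ->|/eqP ->|/hrest].
have HE i j : H i j = (dderivs (v :: rest) f^`M(enum_val i)^`M(enum_val j))@_0%MM.
  by rewrite mxE /= !dderiv_mderiv !dderivs_mderiv.
have Hpos (i j : 'I_#|V0|) : i != j -> [set enum_val i; enum_val j] \in poly_complex W f -> 0 < H i j.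
  move=> ij ijD; rewrite HE; apply: (lor_cone_edge_pos hf) => //.
    by rewrite (inj_eq enum_val_inj).
  by rewrite /= sz.
have H0 (i j : 'I_#|V0|) : i != j -> [set enum_val i; enum_val j] \notin poly_complex W f -> H i j = 0.
  move=> ij; have jNi : enum_val j \notin [set enum_val i].
    by rewrite inE (inj_eq enum_val_inj) eq_sym.
  rewrite (mem_complex hf) negbK setUC sderivU1 // sderiv1 HE => /eqP ->.
  by rewrite linear0 mcoeff0.
have neg := @trickle_down R _ H w (hessian_sym _ _) w0 c0.
have {}neg : forall x : 'rV[R]_#|V0|, bform H x w = 0 -> bform H x x <= 0.
  apply: neg => [i j ij|r hr i j|x].
  - by have [/(Hpos _ _ ij)/ltW//|/(H0 _ _ ij) ->] := boolP ([set enum_val i; enum_val j] \in poly_complex W f).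
  - apply: (connected_constant (D := poly_complex W f)) => //.
      exact: complex_down hf.
    by move=> a b ab abD; apply: hr => //; apply: Hpos.
  (* The form at [X] is the [w]-weighted sum of the forms of the vertex derivatives. Each of these
     is bounded by its reverse Cauchy-Schwarz inequality against [v], whose value at [v] is the
     corresponding entry of [w H]. *)
  have [X XV <-] := coords_surj x; rewrite bform_hessian //.
  have -> : qform q X X = \sum_i w 0 i * qform (dderivs rest f^`M(enum_val i)) X X.
    rewrite /qform -!(dderivC v) -PE; last by do 2 apply: admissible_dderiv.
    rewrite (dderiv_coeff_supported _ PV); apply: eq_bigr => i _.
    by rewrite !dderiv_mderiv gE.
  apply: ler_sum => i _; rewrite -mulrA ler_pM2l // ler_pdivlMr // cE.
  rewrite coords_mulmx_hessian // dderiv_mderiv gE.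
  exact: (K_Lorentzian_vertex _ hf (enum_valP i) (hL _ (enum_valP i)) sz hrest hvv).
have PW : supported W P.
  by move=> i iW; apply: PV; apply: contra iW; apply/subsetP/vertex_set_sub.
have aPq : admissible W f (dderiv P q) by apply: admissible_dderiv.
apply: (hessian_exactly_one PW).
  rewrite /qform (PE _ aPq) (PE _ aq).
  apply: (lor_cone_pos hf (vs := [:: v, v, v & rest])); first by rewrite /= sz.
  by move=> u; rewrite !inE => /or4P[/eqP ->|/eqP ->|/eqP ->|/hrest].
(* The derivatives of [q] along non-vertices vanish, so the passage from [V0] to [W] changes no
   value of the form. *)
move=> x _; set x0 := restrict V0 x.
have x0V : supported V0 x0 := @restrict_supported _ _ _ _.
have := neg (coords V0 x0); rewrite !bform_hessian // => neg'.
move=> xP; have : qform q x0 x0 <= 0.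
  by apply: neg'; rewrite /qform hres.
by rewrite /qform (hres _ _ aq) hres //; apply: admissible_dderiv.
Qed.

(** The cone direction supplies the positive eigenvalue. The hypothesis concerns the variables of
    the link of the empty face, that is the vertices, and is carried over to [W]. *)
Lemma at_most_one_exactly_one W f v : strongly_hereditary 2 W f ->
  lor_cone 2 W f v -> at_most_one_pos_eigenvalue (hessian (vertex_set W f) f) ->
  exactly_one_pos_eigenvalue (hessian W f).
Proof.
move=> hf hv hq; pose V0 := vertex_set W f.
have af := admissible_self hf.
have res x y : qform f (restrict V0 x) (restrict V0 y) = qform f x y.
  rewrite /qform (dderiv_restrict _ (q := f)); last by case: af.
  by rewrite dderiv_restrict //; case: (admissible_dderiv y af).
have vv : 0 < qform f v v.
  apply: (lor_cone_pos hf (vs := [:: v; v])) => // u.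
  by rewrite !inE => /orP[] /eqP ->.
have VW : supported W (restrict V0 v).
  move=> i iW; apply: restrict_supported; apply: contra iW; apply/subsetP/vertex_set_sub.
apply: (hessian_exactly_one VW); first by rewrite res.
move=> x _ xv; have := @hessian_at_most_one_CS R n V0 f (restrict V0 x) (restrict V0 v) hq
  (@restrict_supported _ _ _ _) (@restrict_supported _ _ _ _).
rewrite !res => /(_ vv); rewrite -[qform f x v]res.
suff -> : qform f (restrict V0 x) (restrict V0 v) = 0.
  by rewrite expr0n pmulr_lle0.
rewrite res -xv /qform dderiv_restrict //; case: af => //.
Qed.

(** The bound is that of [H_connected] for the truncation, whose rank is [m - 1], while the links
    are taken in the full complex. *)
Definition links_connected m W f := forall S, S \in poly_complex W f ->
  (#|S| + 3 <= m)%N -> complex_connected (link (poly_complex W f) S).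

Definition links_hessian m W f := forall S, S \in poly_complex W f ->
  (#|S| + 2)%N = m ->
  at_most_one_pos_eigenvalue (hessian (link_vars W f S) (link_poly S f)).

Lemma links_connected_link m W f S : strongly_hereditary m W f ->
  S \in poly_complex W f -> links_connected m W f ->
  links_connected (m - #|S|) (link_vars W f S) (link_poly S f).
Proof.
move=> hf SD hC T; rewrite (link_complex hf) // inE => /andP[TS STD] Tm.
rewrite link_linkE //; apply: hC => //.
by rewrite cardsU disjoint_setI0 1?disjoint_sym // cards0 subn0; lia.
Qed.

Lemma links_hessian_link m W f S : strongly_hereditary m W f ->
  S \in poly_complex W f -> links_hessian m W f ->
  links_hessian (m - #|S|) (link_vars W f S) (link_poly S f).
Proof.
move=> hf SD hQ T; rewrite (link_complex hf) // inE => /andP[TS STD] Tm.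
rewrite (link_vars_link hf) // link_poly_link //; apply: hQ => //.
by rewrite cardsU disjoint_setI0 1?disjoint_sym // cards0 subn0; lia.
Qed.

(** Degree 1 requires positivity only, degree 2 is the Hessian condition at the empty face, and
    higher degrees combine connectedness at the empty face with induction on the vertex links. *)
Theorem local_to_global m W f : strongly_hereditary m.+1 W f ->
  links_connected m.+1 W f -> links_hessian m.+1 W f ->
  K_Lorentzian (lor_cone m.+1 W f) m.+1 W f.
Proof.
elim: m W f => [|m IH] W f hf hC hQ; split; try by case: hf.
  by move=> vs sz hv; split=> //; apply: lor_cone_pos hf sz hv.
move=> vs sz hv; split; first exact: lor_cone_pos hf sz hv.
move=> _; case: m IH hf hC hQ sz hv => [|m] IH hf hC hQ sz hv.
  have -> : drop 2 vs = [::] by apply/nilP; rewrite /nilp size_drop sz.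
  case: vs sz hv => // v vs _ hv.
  apply: (at_most_one_exactly_one hf (hv v (mem_head _ _))).
  have := hQ _ (complex0 hf); rewrite cards0 => /(_ erefl).
  by rewrite /link_vars link0E link_polyE sderiv0 zsub0.
apply: (connected_exactly_one hf).
- by rewrite -[poly_complex W f]link0E; apply: hC; rewrite ?cards0 // (complex0 hf).
- move=> i iV; have iD : [set i] \in poly_complex W f by rewrite -in_vertices.
  have m1 : (m.+3 - #|[set i]| = m.+2)%N by rewrite cards1 subn1.
  have := links_connected_link hf iD hC; have := links_hessian_link hf iD hQ.
  by rewrite m1 => hQ' hC'; apply: IH => //; apply: (vertex_link hf).
- by rewrite size_drop sz subn2.
by move=> v /mem_drop; apply: hv.
Qed.

(** If [A] is the set of vertices reachable from [i] and [B] the set of the other vertices, no edge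
    joins them. The restrictions of [p] to [A] and [B] are then orthogonal positive directions,
    against the reverse Cauchy-Schwarz inequality. *)
Theorem K_Lorentzian_connected m W f v : strongly_hereditary m.+2 W f ->
  lor_cone m.+2 W f v -> K_Lorentzian (lor_cone m.+2 W f) m.+2 W f ->
  complex_connected (poly_complex W f).
Proof.
move=> hf hv [_ hL] i j iV jV; apply/negPn/negP => nij.
pose e := [rel a b : 'I_n | [set a; b] \in poly_complex W f].
have esym : connect_sym e by apply: sym_connect_sym => a b /=; rewrite setUC.
pose A := [set a in vertex_set W f | connect e i a].
pose B := [set a in vertex_set W f | ~~ connect e i a].
set q := dderivs (nseq m v) f.
have [[p [l [[_ p0] Ll vE]]] _] := lor_cone2 hv.
have aq : admissible W f q := admissible_dderivs _ (admissible_self hf).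
have ABf a b : a \in A -> b \in B -> f^`M(a)^`M(b) = 0.
  rewrite !inE => /andP[aV ia] /andP[bV ib].
  have ab : a != b by apply: contraNneq ib => <-.
  have : [set a; b] \notin poly_complex W f.
    by apply: contra ib => abD; apply: connect_trans ia (connect1 _).
  have bNa : b \notin [set a] by rewrite inE eq_sym.
  by rewrite (mem_complex hf) negbK setUC sderivU1 // sderiv1 => /eqP.
have ABq a b : a \in A -> b \in B -> q^`M(a)^`M(b) = 0.
  by move=> aA bB; rewrite !dderivs_mderiv ABf // linear0.
have VE k : (k \in vertex_set W f) = (k \in A) || (k \in B).
  by rewrite !inE; case: connect; rewrite ?andbT ?andbF ?orbF.
have pos k : k \in vertex_set W f -> 0 < (dderiv v q^`M(k))@_0%MM.
  move=> kV; rewrite dderivs_mderiv; apply: (lor_cone_vertex_pos hf kV (vs := v :: nseq m v)).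
    by rewrite /= size_nseq.
  by move=> u; rewrite inE => /orP[/eqP ->//|/nseqP[-> _]].
(* At a vertex of [X] the mixed derivatives with [Y] vanish, so the restriction of [p] to [X] acts
   there like the full direction [v]. *)
have split_pos (X Y : {set 'I_n}) :
    (forall k, (k \in vertex_set W f) = (k \in X) || (k \in Y)) ->
    (forall a b, a \in X -> b \in Y -> q^`M(a)^`M(b) = 0) ->
    (exists k, k \in X) ->
    0 < qform q (restrict X p) (restrict X p).
  move=> XY hXY [k kX]; rewrite /qform dderiv_coeffE.
  have term a : a \in X -> 0 < p 0 a * ((dderiv (restrict X p) q)^`M(a))@_0%MM.
    move=> aX; have aV : a \in vertex_set W f by rewrite XY aX.
    rewrite mulr_gt0 ?p0 ?(subsetP (vertex_set_sub W f)) // dderiv_mderiv.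
    suff -> : dderiv (restrict X p) q^`M(a) = dderiv v q^`M(a) by apply: pos.
    have aqa := admissible_mderiv a aq; rewrite vE -(admissible_pos_part p aqa Ll).
    apply: eq_bigr => b _; rewrite !mxE XY; case: ifP => //= bX; case: ifP => // bY.
    by rewrite hXY // !scaler0.
  rewrite (bigD1 k) //= mxE kX ltr_pwDl ?term // sumr_ge0 // => a _.
  by rewrite mxE; case: ifP => [/term/ltW//|_]; rewrite mul0r.
have xx : 0 < qform q (restrict A p) (restrict A p).
  by apply: (split_pos A B) => //; exists i; rewrite inE iV connect0.
have yy : 0 < qform q (restrict B p) (restrict B p).
  apply: (split_pos B A) => [k|a b aB bA|]; first by rewrite VE orbC.
    by rewrite mderiv_comm ABq.
  by exists j; rewrite inE jV.
have xy : qform q (restrict A p) (restrict B p) = 0.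
  rewrite /qform dderiv_coeffE big1 // => a _; rewrite mxE; case: ifP => aA; last by rewrite mul0r.
  rewrite dderiv_mderiv dderiv_coeffE big1 ?mulr0 // => b _; rewrite mxE.
  by case: ifP => bB; rewrite ?mul0r // ABq // mcoeff0 mulr0.
have sub_supp (X : {set 'I_n}) : X \subset vertex_set W f -> supported W (restrict X p).
  move=> XV k kW; apply: restrict_supported; apply: contra kW => /(subsetP XV).
  exact/subsetP/vertex_set_sub.
have [||_ h1] := hL (nseq m.+2 v); first by rewrite size_nseq.
  by move=> u /nseqP[->].
have := @hessian_at_most_one_CS R n W q (restrict A p) (restrict B p).
rewrite xy expr0n leNgt mulr_gt0 //= => absurd; suff : false by []; apply: absurd => //.
- by apply: exactly_one_pos_at_most; have := h1 isT; rewrite /= drop0.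
- by apply: sub_supp; apply/subsetP => k; rewrite inE => /andP[].
by apply: sub_supp; apply/subsetP => k; rewrite inE => /andP[].
Qed.

End LocalToGlobal.

(** * Passing cones and connectedness to links and truncations *)

Section Criterion.
Context {R : realType} {n : nat}.
Implicit Types (W S T : {set 'I_n}) (f g h q : {mpoly R[n]}) (u v x : 'rV[R]_n).
Implicit Types (D : {set {set 'I_n}}) (m : nat).

Lemma poly_complex_indep m W W' f :
  strongly_hereditary m W f -> strongly_hereditary m W' f ->
  poly_complex W f = poly_complex W' f.
Proof. by move=> hf hf'; apply/setP => S; rewrite (mem_complex hf) (mem_complex hf'). Qed.

(** Membership in the cone depends on a vector only through its derivative of [f]. Allowing [v] and
    [v'] to differ absorbs both the change of variable set and the different dual vectors chosen for
    [W] and [W']. *)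
Lemma lor_cone_transfer m W W' f v v' :
  strongly_hereditary m.+1 W f -> strongly_hereditary m.+1 W' f ->
  W' \subset W -> supported W' v' -> dderiv v' f = dderiv v f ->
  lor_cone m.+1 W f v -> lor_cone m.+1 W' f v'.
Proof.
elim: m W W' f v v' => [|m IH] W W' f v v' hf hf' W'W v'W' vv' hv.
  have [f1 _ _ _] := hf.
  by split=> //; rewrite homog1_eval // vv' -homog1_eval //; case: hv.
have [[p [l [[pW p0] Ll vE]]] hi] := lor_cone2 hv.
have VE := poly_complex_indep hf hf'.
have V0W' : vertex_set W f \subset W' by rewrite /vertex_set VE vertex_set_sub.
split=> [|i]; last first.
  rewrite -VE => iV; have iD : [set i] \in poly_complex W f by rewrite -in_vertices.
  have WE : link_vars W' f [set i] = link_vars W f [set i] by rewrite /link_vars VE.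
  have hi' := vertex_link hf iV; rewrite WE.
  apply: (IH _ _ _ _ _ hi' hi' (subxx _) _ _ (hi i iV)).
    by rewrite -WE; apply: restrict_supported.
  rewrite (link_poly_dderiv hf) //; rewrite VE in iD.
  by rewrite (link_poly_dderiv hf') // !sderiv1 -!dderiv_mderiv vv'.
exists (restrict W' p), (v' - restrict W' p); split; last by rewrite addrC subrK.
  split=> [|i iW']; first exact: restrict_supported.
  by rewrite mxE iW' p0 // (subsetP W'W).
split.
  by move=> i iW'; rewrite !mxE (negPf iW') v'W' // subr0.
rewrite -scaleN1r dderivDl dderivZl vv' vE dderivDl; case: (Ll) => _ ->.
rewrite addr0 dderiv_restrict ?scaleN1r ?subrr //.
by case: hf'.
Qed.

(** The vertices of [S] are projected away one at a time. *)
Lemma lor_cone_link m W f S v : strongly_hereditary m W f ->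
  S \in poly_complex W f -> (#|S| < m)%N -> lor_cone m W f v ->
  exists v', lor_cone (m - #|S|) (link_vars W f S) (link_poly S f) v'.
Proof.
move: {2}#|S| (erefl #|S|) => s; elim: s m W f S v => [|s IH] m W f S v Ss hf SD Sm hv.
  move/eqP: Ss; rewrite cards_eq0 => /eqP S0; subst S.
  have := link_strongly_hereditary hf SD; rewrite link_polyE sderiv0 zsub0 cards0 subn0.
  case: m hf hv Sm => // m hf hv _ hf'.
  (* The link of the empty face has the vertices of the complex as variables instead of [W], whence
     the transfer of the cone. *)
  have VE : link_vars W f finset.set0 = vertex_set W f by rewrite /link_vars link0E.
  exists (restrict (vertex_set W f) v); rewrite VE in hf' *.
  apply: (lor_cone_transfer hf hf' _ _ _ hv); first exact: vertex_set_sub.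
    exact: restrict_supported.
  by apply: dderiv_restrict; case: hf'.
have /card_gt0P[i iS] : (0 < #|S|)%N by rewrite Ss.
have iD : [set i] \in poly_complex W f by rewrite (complex_down hf _ SD) // sub1set.
have iV : i \in vertex_set W f by rewrite in_vertices.
have dis : [disjoint S :\ i & [set i]] by rewrite disjoint_sym disjoints1 !inE eqxx.
have SE : [set i] :|: S :\ i = S by rewrite setD1K.
have cS : #|S :\ i| = s by have := cardsD1 i S; rewrite iS Ss add1n => -[].
case: m hf Sm hv => [|[|m]] hf Sm hv; [by []|by rewrite Ss in Sm|].
have [_ /(_ i iV) hi] := lor_cone2 hv.
have [||v'] := IH _ _ _ (S :\ i) _ cS (vertex_link hf iV) _ _ hi.
- by rewrite (link_complex hf) // inE dis SE.
- by rewrite cS -Ss; lia.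
rewrite (link_vars_link hf) // link_poly_link // SE => hv'.
by exists v'; move: hv'; rewrite cS Ss.
Qed.

Lemma complex_face_extend m W f S j : strongly_hereditary m W f ->
  S \in poly_complex W f -> (#|S| <= j)%N -> (j <= m)%N ->
  exists2 T, T \in poly_complex W f & #|T| = j.
Proof.
move=> hf SD; elim: j => [|j IH] Sj jm.
  by exists S => //; apply/eqP; rewrite -leqn0.
move: Sj; rewrite leq_eqVlt => /orP[/eqP Sj|Sj]; first by exists S.
have [|T TD Tj] := IH Sj; first exact: ltnW.
have [|i iT iTD] := complex_extend hf TD; first by rewrite Tj.
by exists (i |: T) => //; rewrite cardsU1 iT Tj.
Qed.

(** By purity the facets are the faces with [m] elements. *)
Lemma trunc_complex m W f : strongly_hereditary m W f ->
  trunc (poly_complex W f) = [set S in poly_complex W f | (#|S| < m)%N].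
Proof.
move=> hf; apply/setP => S; rewrite [LHS]in_set [RHS]in_set.
have [SD|//] := boolP (S \in poly_complex W f); rewrite /= /is_facet SD /=.
have [Sm|Sm] := ltnP #|S| m.
  have [i iS iSD] := complex_extend hf SD Sm.
  rewrite negb_forall_in; apply/existsP; exists (i |: S).
  rewrite iSD negb_imply subsetUr /=; apply: contra iS => /eqP <-.
  by rewrite setU11.
apply/negbTE; rewrite negbK; apply/forall_inP => T TD; apply/implyP => ST.
by rewrite eq_sym eqEcard ST (leq_trans (complex_card hf TD)).
Qed.

Lemma complex_connected_eq D D' :
  (forall T, (#|T| <= 2)%N -> (T \in D) = (T \in D')) ->
  complex_connected D -> complex_connected D'.
Proof.
move=> DD' hD i j; rewrite !in_vertices -!DD' ?cards1 // -!in_vertices => iV jV.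
rewrite -(@eq_connect _ (fun a b => [set a; b] \in D)); first exact: hD.
by move=> a b; rewrite DD' // cards2; case: (_ != _).
Qed.

(** Purity of the truncation is automatic. Connectedness sees only faces with at most two elements,
    and adding these to a face [S] with [#|S| + 3 <= m] never reaches size [m]; so truncating leaves
    the relevant part of the link intact. *)
Lemma H_connected_trunc m W f : (0 < m)%N -> strongly_hereditary m W f ->
  H_connected (trunc (poly_complex W f)) <-> links_connected m W f.
Proof.
move=> m0 hf; set D := poly_complex W f; have tE := trunc_complex hf.
have in_trunc S : (S \in trunc D) = (S \in D) && (#|S| < m)%N by rewrite tE inE.
have rk : complex_rank (trunc D) = m.-1.
  apply/eqP; rewrite eqn_leq; apply/andP; split.
    by apply/bigmax_leqP => S; rewrite in_trunc => /andP[_ Sm]; lia.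
  have [||T TD Tm] := @complex_face_extend _ _ _ finset.set0 m.-1 hf (complex0 hf).
  - by rewrite cards0.
  - exact: leq_pred.
  rewrite -Tm.
  apply: (@leq_bigmax_cond _ (mem (trunc D)) (fun S : {set 'I_n} => #|S|) T).
  by rewrite /= in_trunc TD; lia.
have linkE S T : (#|S| + 3 <= m)%N -> (#|T| <= 2)%N ->
    (T \in link (trunc D) S) = (T \in link D S).
  move=> Sm T2; rewrite ![_ \in link _ _]inE in_trunc; congr (_ && _).
  rewrite andb_idr // => _; by have := (leq_card_setU S T).1; lia.
split=> [[_ h] S SD Sm|h].
  apply: (@complex_connected_eq (link (trunc D) S)); first by move=> T; apply: linkE.
  by apply: h; rewrite ?rk ?in_trunc ?SD; lia.
split=> [S|S].
  rewrite rk /is_facet => /andP[StD /forall_inP hS].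
  move: (StD); rewrite in_trunc => /andP[SD Sm]; apply/eqP; rewrite eqn_leq -ltnS prednK // Sm /=.
  rewrite leqNgt; apply/negP => Sm'.
  have [i iS iSD] := complex_extend hf SD Sm.
  have /hS : i |: S \in trunc D by rewrite in_trunc iSD cardsU1 iS /= -(prednK m0) ltnS.
  by rewrite subsetUr /= => /eqP E; rewrite -E setU11 in iS.
rewrite in_trunc rk => /andP[SD Sm] S2.
have S3 : (#|S| + 3 <= m)%N by lia.
apply: (@complex_connected_eq (link D S)); last exact: h.
by move=> T T2; rewrite linkE.
Qed.

(** Both conditions are inherited by links, so [local_to_global] applies to each of them.
    Conversely, [v] is carried to every link, where it provides the directions in which the
    Lorentzian property is tested. *)
Theorem hereditary_Lorentzian_iff m W f v : (0 < m)%N ->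
  strongly_hereditary m W f -> lor_cone m W f v ->
  hereditary_Lorentzian m W f <->
  H_connected (trunc (poly_complex W f)) /\ links_hessian m W f.
Proof.
move=> m0 hf hv; rewrite (H_connected_trunc m0 hf).
have in_trunc S : (S \in trunc (poly_complex W f)) =
    (S \in poly_complex W f) && (#|S| < m)%N by rewrite (trunc_complex hf) inE.
split=> [[_ hL]|[hC hQ]].
  split=> S SD Sm; have Sm' : (#|S| < m)%N by lia.
    have [v' hv'] := lor_cone_link hf SD Sm' hv.
    rewrite -(link_complex hf) //.
    have [e mE] : exists e, (m - #|S| = e.+2)%N by exists (m - #|S|).-2; lia.
    have := hL S; rewrite in_trunc SD Sm' => /(_ isT); have := link_strongly_hereditary hf SD.
    by rewrite mE in hv' * => hf' hL'; apply: (K_Lorentzian_connected hf' hv').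
  have [v' hv'] := lor_cone_link hf SD Sm' hv.
  have mE : (m - #|S| = 2)%N by lia.
  (* In degree 2 both directions are dropped before the Hessian is taken, which leaves the Hessian
     of the link polynomial itself. *)
  have := hL S; rewrite in_trunc SD Sm' => /(_ isT); rewrite mE in hv' * => -[_ /(_ [:: v'; v'])].
  case=> // [u|_ /(_ isT)]; first by rewrite !inE => /orP[] /eqP ->.
  exact: exactly_one_pos_at_most.
split=> [T|S].
  by rewrite in_trunc => /andP[TD _]; case: hf => _ _ _; apply.
rewrite in_trunc => /andP[SD Sm].
have := links_connected_link hf SD hC; have := links_hessian_link hf SD hQ.
have := link_strongly_hereditary hf SD.
have [e ->] : exists e, (m - #|S| = e.+1)%N by exists (m - #|S|).-1; lia.
by move=> hf' hQ' hC'; apply: local_to_global.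
Qed.

Lemma poly_complex_zero W : poly_complex W (0 : {mpoly R[n]}) = finset.set0.
Proof. by apply/setP => S; rewrite !inE /sderiv linear0 eqxx andbF. Qed.

Lemma trunc_set0 : trunc finset.set0 = finset.set0 :> {set {set 'I_n}}.
Proof. by apply/setP => S; rewrite !inE. Qed.

Lemma hereditary_Lorentzian_zero m W : hereditary_Lorentzian m W (0 : {mpoly R[n]}).
Proof.
by rewrite /hereditary_Lorentzian /hereditary poly_complex_zero trunc_set0;
  split=> S; rewrite inE.
Qed.

Lemma H_connected_set0 : H_connected (finset.set0 : {set {set 'I_n}}).
Proof. by split=> S; rewrite /is_facet inE. Qed.

End Criterion.

(** * Volume polynomials of simplicial fans *)

Section FanRays.
Context {R : realType} {U : vectType R} {n : nat} (Sigma : simplicialFan U n).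

Definition lin_extend (s : seq U) (w : 'I_(size s) -> R) (v : U) : R^o :=
  \sum_j w j * coord (in_tuple s) j v.

Lemma lin_extend_is_linear s w : linear (@lin_extend s w).
Proof.
move=> a u v; rewrite /lin_extend scaler_sumr -big_split; apply: eq_bigr => j _ /=.
by rewrite linearP mulrDr [a *: _]mulrCA.
Qed.

HB.instance Definition _ s w :=
  GRing.isLinear.Build R U R^o _ (@lin_extend s w) (@lin_extend_is_linear s w).

Lemma lin_extend_free s w (j : 'I_(size s)) : free s -> lin_extend w s`_j = w j.
Proof.
move=> fs; rewrite /lin_extend (bigD1 j) //= big1 => [|k kj].
  by rewrite (coord_free (X := in_tuple s) j j) // eqxx mulr1 addr0.
by rewrite (coord_free (X := in_tuple s) j k) // eq_sym (negPf kj) mulr0.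
Qed.

Lemma cone1P (u v : U) : cone [:: u] v <-> exists2 c, 0 <= c & v = c *: u.
Proof.
split=> [[c c0 ->]|[c c0 ->]]; first by exists (c ord0); rewrite // big_ord1.
by exists (fun=> c); rewrite // big_ord1.
Qed.

Lemma cone1Z (u : U) a : 0 < a -> cone [:: a *: u] = cone [:: u].
Proof.
move=> a0; apply/seteqP; split=> v /cone1P[c c0 ->]; apply/cone1P.
  by exists (c * a); rewrite ?scalerA // mulr_ge0 // (ltW a0).
exists (c / a); first by rewrite divr_ge0 // (ltW a0).
by rewrite scalerA divfK ?gt_eqF.
Qed.

Lemma cone_mem (s : seq U) (j : 'I_(size s)) : cone s s`_j.
Proof.
exists (fun k => (k == j)%:R); first by move=> k; rewrite ler0n.
rewrite (bigD1 j) //= eqxx scale1r big1 ?addr0 // => k /negPf ->.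
by rewrite scale0r.
Qed.

(** The functional cutting out the face is nonnegative on the cone and zero at [r], hence zero on
    each generator occurring in [r]. Such a generator lies in the face, which is the ray of [r]. *)
Lemma face_ray (s : seq U) (r : U) : free s -> r != 0 ->
  is_face (cone [:: r]) (cone s) ->
  exists (j : 'I_(size s)) c, 0 < c /\ r = c *: s`_j.
Proof.
move=> fs r0 [lam lam_ge0 faceE].
have : cone [:: r] r by apply/cone1P; exists 1; rewrite ?scale1r.
rewrite {1}faceE => -[[c c0 rE] lamr].
have [j cj] : exists j, c j != 0.
  apply/existsP; rewrite -negb_forall; apply: contra r0 => /forallP h.
  by rewrite rE big1 // => j _; rewrite (eqP (h j)) scale0r.
have lamj : lam s`_j = 0.
  have : \sum_i c i * lam s`_i == 0.
    apply/eqP; rewrite -[RHS]lamr rE linear_sum; apply: eq_bigr => i _.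
    by rewrite linearZ.
  rewrite psumr_eq0 => [/allP/(_ j (mem_index_enum j))|i _].
    by rewrite /= mulf_eq0 (negPf cj) => /eqP.
  by rewrite mulr_ge0 //; apply: lam_ge0; apply: cone_mem.
have : cone [:: r] s`_j by rewrite faceE; split=> //; apply: cone_mem.
move=> /cone1P[a a0 sE].
have an0 : a != 0.
  apply: contra_neq (free_not0 fs (mem_nth 0 (ltn_ord j))) => az.
  by rewrite sE az scale0r.
exists j, a^-1; split; first by rewrite invr_gt0 lt_def an0.
by rewrite sE scalerA mulVf // scale1r.
Qed.

(** The cone of [S] is only known to be generated by some free list [s]. The rays of [S] are matched
    with positive multiples of distinct elements of [s], on which a functional can be prescribed. *)
Lemma fan_complex_interpolate S (y : 'rV[R]_n) : fan_complex Sigma S ->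
  exists2 l, fan_lin Sigma l & forall i, i \in S -> l 0 i = y 0 i.
Proof.
rewrite /fan_complex /= => SigS; have [s fs sE] := fan_simplicial SigS.
have ray_in i : i \in S -> cone s (ray Sigma i).
  move=> iS; rewrite -sE; have iE : i \in enum S by rewrite mem_enum.
  have ltS : (index i (enum S) < size [seq ray Sigma i | i <- enum S])%N.
    by rewrite size_map index_mem.
  have := cone_mem (Ordinal ltS); rewrite /= (nth_map i) ?index_mem //.
  by rewrite nth_index.
have face i : i \in S -> exists (j : 'I_(size s)) c, 0 < c /\ ray Sigma i = c *: s`_j.
  move=> iS; apply: face_ray => //; first exact: ray_neq0.
  (* The ray lies in the cone, so their intersection is the ray, which is therefore a face. *)
  have [_] := fan_inter (ray_cone Sigma i) SigS.
  rewrite sE (_ : (cone [:: ray Sigma i] `&` cone s)%classic = cone [:: ray Sigma i]) //.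
  apply/seteqP; split=> [v []//|v /cone1P[c c0 ->]]; split; first by apply/cone1P; exists c.
  have [d d0 ->] := ray_in i iS; exists (fun j => c * d j).
    by move=> j; rewrite mulr_ge0.
  by rewrite scaler_sumr; apply: eq_bigr => j _; rewrite scalerA.
(* A nonempty [S] provides the index [j0], used as default value outside [S]. *)
have [S0|[i0 i0S]] := set_0Vmem S.
  exists (\row_i lin_extend (fun _ : 'I_(size s) => 0) (ray Sigma i)).
    by exists (lin_extend (fun _ : 'I_(size s) => 0)) => i; rewrite mxE.
  by move=> i; rewrite S0 inE.
have [j0 _] := face i0 i0S.
have face' i : exists p : 'I_(size s) * R, i \in S -> 0 < p.2 /\ ray Sigma i = p.2 *: s`_p.1.
  have [/face[k [a h]]|_] := boolP (i \in S); first by exists (k, a).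
  by exists (j0, 0).
have [p hp] := choice face'.
pose j i := (p i).1; pose c i := (p i).2.
have jcP i : i \in S -> 0 < c i /\ ray Sigma i = c i *: s`_(j i) by apply: hp.
have jinj : {in S &, injective j}.
  move=> a b aS bS jab; apply: (@ray_inj _ _ _ Sigma).
  have [ca ->] := jcP a aS; have [cb ->] := jcP b bS.
  by rewrite !cone1Z // jab.
(* By injectivity of [j] on [S] the sum has at most one term; dividing by [c i] undoes the scaling
   of the generator. *)
pose w k := \sum_(i in S | j i == k) y 0 i / c i.
exists (\row_i lin_extend w (ray Sigma i)).
  by exists (lin_extend w) => i; rewrite mxE.
move=> i iS; rewrite mxE; have [ci ->] := jcP i iS.
rewrite [lin_extend w _]linearZ /= lin_extend_free // /w (bigD1 i) ?iS ?eqxx //=.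
rewrite big1 => [|k /andP[/andP[kS /eqP jk] ki]].
  by rewrite addr0 [_ *: _]mulrC divfK ?gt_eqF.
by rewrite (jinj k i kS iS jk) eqxx in ki.
Qed.

End FanRays.

Lemma scale_mulrn (A : comNzRingType) (V : lmodType A) (a b : A) (q : V) e N :
  (a *: ((b *: q) *+ e)) *+ N = ((a * b) *: q) *+ (N * e).
Proof. by rewrite -scalerMnr scalerA mulnC mulrnA. Qed.

(** * Derivatives of the volume polynomial and the relations of the Chow ring *)

Section VolumePolynomial.
Context {R : realType} {U : vectType R} {n : nat} (Sigma : simplicialFan U n).
Local Notation A := (chow_ring Sigma).
Local Notation chow := (to_chow Sigma).
Local Notation piece := (chow_piece (Sigma := Sigma)).
Implicit Types (p : {mpoly R[n]}) (a b : A).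

Lemma to_chowD p q : chow (p + q) = chow p + chow q.
Proof. exact: (raddfD \pi_({ideal_quot (chow_ideal Sigma)})). Qed.

Lemma to_chowM p q : chow (p * q) = chow p * chow q.
Proof. exact: (rmorphM \pi_({ideal_quot (chow_ideal Sigma)})). Qed.

Lemma to_chow0 : chow 0 = 0.
Proof. exact: (raddf0 \pi_({ideal_quot (chow_ideal Sigma)})). Qed.

Lemma to_chow1 : chow 1 = 1.
Proof. exact: (rmorph1 \pi_({ideal_quot (chow_ideal Sigma)})). Qed.

Lemma to_chow_sum (I : Type) (r : seq I) (F : I -> {mpoly R[n]}) :
  chow (\sum_(i <- r) F i) = \sum_(i <- r) chow (F i).
Proof. exact: (raddf_sum \pi_({ideal_quot (chow_ideal Sigma)})). Qed.

Lemma to_chow_eq0 p : p \in chow_ideal Sigma -> chow p = 0.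
Proof.
move=> pI; rewrite -to_chow0; apply/eqP; rewrite /to_chow.
by rewrite -(Quotient.idealrBE (chow_ideal Sigma)) subr0.
Qed.

Lemma to_chow_lin l : fan_lin Sigma l -> chow (\sum_i l 0 i *: 'X_i) = 0.
Proof.
move=> Ll; apply: to_chow_eq0; apply/asboolP; exists 0, (\sum_i l 0 i *: 'X_i); split.
- by exists [::]; rewrite ?big_nil.
- exists [:: (1, \sum_i l 0 i *: 'X_i)]; last by rewrite big_seq1 mul1r.
  by move=> q; rewrite inE => /eqP -> /=; exists l.
- by rewrite add0r.
Qed.

Lemma to_chow_nonface (T : {set 'I_n}) : ~ fan_complex Sigma T ->
  chow (\prod_(i in T) 'X_i) = 0.
Proof.
move=> nT; apply: to_chow_eq0; apply/asboolP; exists (\prod_(i in T) 'X_i), 0; split.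
- exists [:: (1, \prod_(i in T) 'X_i)]; last by rewrite big_seq1 mul1r.
  by move=> q; rewrite inE => /eqP -> /=; exists T.
- by exists [::]; rewrite ?big_nil.
- by rewrite addr0.
Qed.

Lemma const_homog (c : R) : (c%:MP : {mpoly R[n]}) \is 0.-homog.
Proof. by rewrite -alg_mpolyC; apply/dhomogZ/dhomog1. Qed.

Lemma chow_piece0 k : piece k 0.
Proof. by exists 0; [apply: dhomog0 | rewrite to_chow0]. Qed.

Lemma chow_pieceD k a b : piece k a -> piece k b -> piece k (a + b).
Proof.
by move=> [p hp ->] [q hq ->]; exists (p + q); [apply: rpredD | rewrite to_chowD].
Qed.

Lemma chow_pieceM k k' a b : piece k a -> piece k' b -> piece (k + k') (a * b).
Proof.
by move=> [p hp ->] [q hq ->]; exists (p * q); [apply: dhomogM | rewrite to_chowM].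
Qed.

Lemma chow_piece_sum k (I : Type) (r : seq I) (P : pred I) (F : I -> A) :
  (forall i, P i -> piece k (F i)) -> piece k (\sum_(i <- r | P i) F i).
Proof.
by move=> h; apply: big_ind => //; [apply: chow_piece0 | apply: chow_pieceD].
Qed.

Lemma chow_pieceMn k a N : piece k a -> piece k (a *+ N).
Proof.
move=> ha; elim: N => [|N IH]; first by rewrite mulr0n; apply: chow_piece0.
by rewrite mulrS; apply: chow_pieceD.
Qed.

Lemma chow_pieceX i : piece 1 (chow 'X_i).
Proof. by exists 'X_i => //; rewrite dhomogX /= mdeg1. Qed.

Local Notation gpow k := (generic_power Sigma k).

(** [alpha] is linear on the degree [k] piece only, so its arguments have to be located there. *)
Lemma generic_power_coeff k mu : piece k (gpow k)@_mu.
Proof.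
rewrite /generic_power; elim: k mu => [|k IH] mu.
  rewrite expr0 mcoeff1; exists ((mu == 0%MM)%:R)%:MP; first exact: const_homog.
  by case: (mu == _); rewrite ?mpolyC0 ?mpolyC1 ?to_chow0 ?to_chow1.
rewrite exprS mcoeffM; apply: chow_piece_sum => -[nu1 nu2] _ /=.
apply: (@chow_pieceM 1 k) => //; rewrite raddf_sum /=; apply: chow_piece_sum => i _.
rewrite mcoeffZ mcoeffX; case: eqP => _; rewrite ?mulr1 ?mulr0.
  exact: chow_pieceX.
exact: chow_piece0.
Qed.

Lemma generic_power_homog k : gpow k \is k.-homog.
Proof.
rewrite /generic_power -{2}[k]mul1n; apply: dhomogMn; apply: rpred_sum => i _.
by apply: rpredZ; rewrite dhomogX /= mdeg1.
Qed.

Lemma generic_power_mderiv k i : (gpow k)^`M(i) = (chow 'X_i *: gpow k.-1) *+ k.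
Proof.
rewrite /generic_power; set L := \sum_(j < n) _.
have dL : L^`M(i) = (chow 'X_i)%:MP.
  rewrite raddf_sum /= (bigD1 i) //= big1 ?addr0 => [|j ji].
    by rewrite mderivZ mderivX mnm1E eqxx scale1r -[X in (X - _)%MM]add0m addmK mpolyX0 alg_mpolyC.
  by rewrite mderivZ mderivX mnm1E (negPf ji) scale0r scaler0.
elim: k => [|k IH]; first by rewrite expr0 mulr0n -mpolyC1 mderivC.
rewrite exprS mderivM dL IH mul_mpolyC /= mulrS; congr (_ + _).
case: k {IH} => [|k]; first by rewrite !mulr0n mulr0.
by rewrite mulrnAr -scalerAr -exprS.
Qed.

(** Differentiating along [S] brings down the monomial of [S]. The multiplicity [N] can stay
    implicit, because the factor alone decides the vanishing for nonfaces. *)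
Lemma generic_power_mderivm k (S : {set 'I_n}) :
  exists N, (gpow k)^`M[mesym1 S] = (chow (\prod_(i in S) 'X_i) *: gpow (k - #|S|)) *+ N.
Proof.
move: {2}#|S| (erefl #|S|) => s; elim: s S => [|s IH] S Ss.
  move/eqP: Ss; rewrite cards_eq0 => /eqP ->; exists 1%N.
  by rewrite mesym1_set0 mderivm0m big_set0 to_chow1 scale1r cards0 subn0.
have /card_gt0P[i iS] : (0 < #|S|)%N by rewrite Ss.
have cS : #|S :\ i| = s by have := cardsD1 i S; rewrite iS Ss add1n => -[].
have [N NE] := IH _ cS; exists (N * (k - s))%N.
have SE : mesym1 S = (mesym1 (S :\ i) + U_(i))%MM.
  apply/mnmP => j; rewrite mnmDE mnm1E /mesym1 !mnmE !inE [i == j]eq_sym.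
  by case: (eqVneq j i) => [->|_]; rewrite ?iS ?addn0.
have PE : chow (\prod_(j in S) 'X_j) = chow (\prod_(j in S :\ i) 'X_j) * chow 'X_i.
  rewrite -to_chowM (bigD1 i iS) /= mulrC; congr (chow (_ * _)).
  by apply: eq_bigl => j; rewrite !inE andbC.
rewrite SE mderivmDm NE mderivmU1m mderivMn mderivZ generic_power_mderiv PE.
rewrite cS Ss subnS; exact: scale_mulrn.
Qed.

Section Functional.
Variables (k : nat) (alpha : chow_dual Sigma k).

Lemma chow_dual0 : alpha 0 = 0.
Proof.
have := chow_dual_linear alpha 1 (chow_piece0 k) (chow_piece0 k).
by rewrite mulr0 addr0 mul1r => /eqP; rewrite -subr_eq subrr eq_sym => /eqP.
Qed.

Lemma chow_dual_sum (I : Type) (r : seq I) (c : I -> R) (F : I -> A) :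
  (forall i, piece k (F i)) ->
  alpha (\sum_(i <- r) chow (c i)%:MP * F i) = \sum_(i <- r) c i * alpha (F i).
Proof.
move=> hF; elim: r => [|i r IH]; first by rewrite !big_nil chow_dual0.
rewrite !big_cons chow_dual_linear ?IH //; apply: chow_piece_sum => j _.
rewrite -[k]add0n; apply: chow_pieceM => //.
by exists (c j)%:MP => //; apply: const_homog.
Qed.

Lemma chow_dualD a b : piece k a -> piece k b -> alpha (a + b) = alpha a + alpha b.
Proof.
move=> ha hb; have := chow_dual_linear alpha 1 ha hb.
by rewrite mpolyC1 to_chow1 !mul1r.
Qed.

Lemma chow_dualMn a N : piece k a -> alpha (a *+ N) = alpha a *+ N.
Proof.
move=> ha; elim: N => [|N IH]; first by rewrite !mulr0n chow_dual0.
by rewrite !mulrS chow_dualD ?IH //; apply: chow_pieceMn.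
Qed.

Local Notation f := (vol_poly alpha).

Lemma vol_poly_coeff mu : f@_mu = (k`!%:R)^-1 * alpha (gpow k)@_mu.
Proof.
rewrite /vol_poly mcoeffZ raddf_sum /=; congr (_ * _).
have [mus|mus] := boolP (mu \in msupp (gpow k)).
  rewrite (bigD1_seq mu) ?msupp_uniq //= mcoeffZ mcoeffX eqxx mulr1 big1 ?addr0 //.
  by move=> nu /negPf nm; rewrite mcoeffZ mcoeffX nm mulr0.
rewrite (memN_msupp_eq0 mus) chow_dual0 big_seq big1 // => nu nus.
rewrite mcoeffZ mcoeffX; case: eqP nus mus => [->->//|_ _ _]; exact: mulr0.
Qed.

Lemma vol_poly_homog : f \is k.-homog.
Proof.
apply/homog_coeffP => mu; rewrite vol_poly_coeff => h; apply/eqP; apply: contraNT h => hmu.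
by rewrite (dhomog_nemf_coeff (generic_power_homog k)) // chow_dual0 mulr0.
Qed.

Lemma vol_poly_mderivm m mu :
  (f^`M[m])@_mu = (k`!%:R)^-1 * alpha ((gpow k)^`M[m])@_mu.
Proof.
rewrite !mcoeff_mderivm vol_poly_coeff chow_dualMn ?mulrnAr //.
exact: generic_power_coeff.
Qed.

(** Differentiating the generic power along [l] brings down the linear form of [l], which is zero in
    the Chow ring. *)
Lemma vol_poly_lin l : fan_lin Sigma l -> dderiv l f = 0.
Proof.
move=> Ll; apply/mpolyP => mu; rewrite mcoeff0 raddf_sum /=.
pose g i := ((gpow k)^`M(i))@_mu.
have gE i : piece k (g i).
  by rewrite /g mcoeff_mderiv; apply/chow_pieceMn/generic_power_coeff.
transitivity ((k`!%:R)^-1 * alpha (\sum_i chow (l 0 i)%:MP * g i)).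
  rewrite chow_dual_sum // mulr_sumr; apply: eq_bigr => i _.
  by rewrite mcoeffZ -mderivmU1m vol_poly_mderivm mderivmU1m mulrCA.
suff -> : \sum_i chow (l 0 i)%:MP * g i = 0 by rewrite chow_dual0 mulr0.
transitivity ((chow (\sum_i l 0 i *: 'X_i) * (gpow k.-1)@_mu) *+ k); last first.
  by rewrite to_chow_lin // mul0r mul0rn.
rewrite to_chow_sum mulr_suml -sumrMnl; apply: eq_bigr => i _.
rewrite /g generic_power_mderiv mcoeffMn mcoeffZ mulrnAr -mul_mpolyC to_chowM.
by rewrite mulrA.
Qed.

Lemma vol_poly_face (S : {set 'I_n}) : sderiv S f != 0 -> fan_complex Sigma S.
Proof.
move=> Sf; apply: contrapT => nS; move/eqP: Sf; apply; apply/mpolyP => mu.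
have [N NE] := generic_power_mderivm k S.
rewrite mcoeff0 /sderiv vol_poly_mderivm NE to_chow_nonface // scale0r mul0rn.
by rewrite mcoeff0 chow_dual0 mulr0.
Qed.

Lemma vol_poly_strongly_hereditary : f != 0 -> strongly_hereditary k [set: 'I_n] f.
Proof.
move=> f0; split=> // [|j|S]; first exact: vol_poly_homog.
  by rewrite inE.
rewrite inE => /andP[_ /vol_poly_face SigS] y.
have [l Ll hl] := fan_complex_interpolate y SigS.
by exists l => //; split; [move=> i; rewrite inE | apply: vol_poly_lin].
Qed.

End Functional.
End VolumePolynomial.

Theorem theorem7p10 (R : realType) (U : vectType R) (n d k : nat)
    (Sigma : simplicialFan U n) (alpha : chow_dual Sigma k)
    (hd : fan_dim Sigma d) (hk : (1 <= k <= d)%N)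
    (hK : exists v : 'rV[R]_n, lor_cone k [set: 'I_n] (vol_poly alpha) v) :
  hereditary_Lorentzian k [set: 'I_n] (vol_poly alpha) <->
  H_connected (trunc (poly_complex [set: 'I_n] (vol_poly alpha))) /\
  (forall S : {set 'I_n}, S \in poly_complex [set: 'I_n] (vol_poly alpha) ->
    (#|S| + 2)%N = k ->
    at_most_one_pos_eigenvalue
      (hessian (link_vars [set: 'I_n] (vol_poly alpha) S)
               (link_poly S (vol_poly alpha)))).
Proof.
(* The zero polynomial is not strongly hereditary, yet for [k >= 2] its cone is nonempty, there
   being no vertex to test. Its complex lacks even the empty face, and both sides hold vacuously. *)
have [f0|f0] := eqVneq (vol_poly alpha) 0.
  rewrite f0 poly_complex_zero trunc_set0; split=> _; last exact: hereditary_Lorentzian_zero.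
  by split; [exact: H_connected_set0 | move=> S; rewrite inE].
have [v hv] := hK; have [k0 _] := andP hk.
exact: (hereditary_Lorentzian_iff k0 (vol_poly_strongly_hereditary f0) hv).
Qed.
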